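(* Let $U\subset\mathbb{C}_\tau$ and $\Omega\subset\mathbb{C}^n_z$ be bounded domains and $\varphi\colon U\times\Omega\to\mathbb{R}$ a plurisubharmonic function that is smooth on $\overline{U\times\Omega}$. Let $g\colon U\to\mathbb{R}_{\ge0}$ be non-negative and assume $$\frac{\partial^2\varphi}{\partial\tau\partial\bar\tau}(\tau,z)-\left|\frac{\partial\varphi}{\partial\tau}(\tau,z)\right|^2\geq g(\tau)\quad\text{on }U\times\Omega.$$ Define $\Phi$ by $e^{-\Phi(\tau)}=\int_{z\in\Omega}e^{-\varphi(\tau,z)}$ and $$G(\tau)=g(\tau)+\frac{\left|\int_{z\in\Omega}\frac{\partial\varphi}{\partial\tau}(\tau,z)e^{-\varphi(\tau,z)}\right|^2}{\left(\int_{z\in\Omega}e^{-\varphi(\tau,z)}\right)^2}.$$ Then for every $a\in U$ and every $\varepsilon>0$ there exists $r_\varepsilon\in(0,\delta(a))$ such that for all $r\in(0,r_\varepsilon)$, $L_\Phi(a,r)\leq e^{-\max\{\frac{G(a)-\varepsilon}{2},0\}r^2}$; that is, there exists a holomorphic function $f_r$ on $\Delta(a;r)$ with $f_r(a)=1$ and $$\int_{\Delta(a;r)\times\Omega}|f_r(\tau)|^2e^{-\varphi(\tau,z)}\leq e^{-\max\{\frac{G(a)-\varepsilon}{2},0\}r^2}\,\pi r^2\int_\Omega e^{-\varphi(a,z)}.$$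
   Context: $\Delta(a;r)=\{\tau\in\mathbb{C}\mid|\tau-a|<r\}$; $\delta(a)=\sup\{r>0\mid\Delta(a;r)\subset U\}$. For $0<r<\delta(a)$, $L_\Phi(a,r)=\inf\{\int_{\Delta(a;r)}|f|^2e^{-\Phi}/(\pi r^2e^{-\Phi(a)})\mid f\text{ holomorphic on }\Delta(a;r),\ \int_{\Delta(a;r)}|f|^2e^{-\Phi}<\infty,\ f(a)=1\}$. *)

(* Defs.v *)
From HB Require Import structures.
From mathcomp Require Import all_boot all_order all_algebra.
From mathcomp Require Import all_classical all_reals all_analysis.
From mathcomp.real_closed Require Import complex.

Set Implicit Arguments.
Unset Strict Implicit.
Unset Printing Implicit Defensive.

Import Order.TTheory GRing.Theory Num.Theory.
Import numFieldNormedType.Exports.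

Local Open Scope classical_set_scope.
Local Open Scope ring_scope.

Section Defs.
Variable R : realType.
Local Notation C := R[i].

Definition cre (x : C) : R := let: Complex a _ := x in a.
Definition cim (x : C) : R := let: Complex _ b := x in b.
Definition cabs (x : C) : R := Num.sqrt (cre x ^+ 2 + cim x ^+ 2).

Definition iC : C := Complex 0 1.

Definition disc (a : C) (r : R) : set C := [set t | cabs (t - a) < r].

Definition delta (U : set C) (a : C) : R :=
  sup [set r | 0 < r /\ disc a r `<=` U].

Definition holomorphic_on (D : set C) (f : C -> C) : Prop :=
  forall t, D t -> exists l : C, forall eps : R, 0 < eps ->
    exists del : R, 0 < del /\
      forall h : C, 0 < cabs h -> cabs h < del ->
        cabs ((f (t + h) - f t) / h - l) < eps.

(* real coordinates on C^m : v = (Re z_1..Re z_m, Im z_1..Im z_m) *)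
Definition toC (m : nat) (v : 'rV[R]_(m + m)) : 'rV[C]_m :=
  \row_j Complex (v 0 (lshift m j)) (v 0 (rshift m j)).
Definition ofC (m : nat) (z : 'rV[C]_m) : 'rV[R]_(m + m) :=
  row_mx (map_mx cre z) (map_mx cim z).

(* topological notions on C^m, through the identification C^m = R^(2m) *)
Definition domainC (m : nat) (A : set 'rV[C]_m) : Prop :=
  open (@toC m @^-1` A) /\ connected (@toC m @^-1` A) /\ (A !=set0).
Definition boundedC (m : nat) (A : set 'rV[C]_m) : Prop :=
  bounded_set (@toC m @^-1` A).

Definition asC1 (U : set C) : set 'rV[C]_1 := [set w | U (w 0 0)].

Definition pt (n : nat) (t : C) (z : 'rV[C]_n) : 'rV[C]_(1 + n) :=
  row_mx (\row_(_ < 1) t) z.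
Definition tau_of (n : nat) (w : 'rV[C]_(1 + n)) : C := w 0 (lshift n ord0).
Definition z_of (n : nat) (w : 'rV[C]_(1 + n)) : 'rV[C]_n := rsubmx w.
Definition prodC (n : nat) (U : set C) (O : set 'rV[C]_n) : set 'rV[C]_(1 + n) :=
  [set w | U (tau_of w) /\ O (z_of w)].
Definition uncurryC (n : nat) (phi : C -> 'rV[C]_n -> R) (w : 'rV[C]_(1 + n)) : R :=
  phi (tau_of w) (z_of w).

Definition psh (m : nat) (D : set 'rV[C]_m) (u : 'rV[C]_m -> R) : Prop :=
  (forall v, D (@toC m v) -> forall e : R, 0 < e ->
      \forall y \near v, u (@toC m y) < u (@toC m v) + e) /\
  (forall a b : 'rV[C]_m,
      (forall l : C, cabs l <= 1 -> D (a + l *: b)) ->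
      ((((2 * pi) * u a)%R)%:E <=
         \int[lebesgue_measure]_(th in `[0%R, (2 * pi)%R])
            (u (a + (Complex (cos th) (sin th)) *: b)%R)%:E)%E).

Fixpoint iterD (V : normedModType R) (vs : seq V) (f : V -> R) : V -> R :=
  match vs with
  | [::] => f
  | v :: vs' => 'D_v (iterD vs' f)
  end.

Definition smooth_on_closure (V : normedModType R) (D : set V) (f : V -> R) : Prop :=
  forall vs : seq V,
    (forall x, D x -> differentiable (iterD vs f) x) /\
    exists h : V -> R, {within closure D, continuous h} /\
      forall x, D x -> h x = iterD vs f x.

(* Lebesgue integral of a nonnegative function on R^m, written as an
   iterated integral (Tonelli) of one-dimensional Lebesgue integrals *)
Fixpoint iint (m : nat) : ('rV[R]_m -> \bar R) -> \bar R :=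
  match m with
  | 0 => fun h => h 0
  | m'.+1 => fun h =>
      (\int[lebesgue_measure]_x iint (fun y : 'rV[R]_m' => h (row_mx (\row_(_ < 1) x) y)))%E
  end.

Definition intC (m : nat) (h : 'rV[C]_m -> \bar R) : \bar R :=
  iint (fun v : 'rV[R]_(m + m) => h (@toC m v)).

Definition rintC (m : nat) (A : set 'rV[C]_m) (h : 'rV[C]_m -> R) : R :=
  fine (intC (fun z => (\1_A z * Num.max (h z) 0)%:E)) -
  fine (intC (fun z => (\1_A z * Num.max (- h z) 0)%:E)).

Definition cintC (m : nat) (A : set 'rV[C]_m) (h : 'rV[C]_m -> C) : C :=
  Complex (rintC A (fun z => cre (h z))) (rintC A (fun z => cim (h z))).

Section Phi.
Variables (n : nat) (phi : C -> 'rV[C]_n -> R).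

Definition phiR (v : 'rV[R]_((1 + n) + (1 + n))) : R := uncurryC phi (@toC (1 + n) v).

Definition e_s : 'rV[R]_((1 + n) + (1 + n)) := ofC (pt 1 0).
Definition e_t : 'rV[R]_((1 + n) + (1 + n)) := ofC (pt iC 0).

(* d phi / d tau = (d_s phi - i d_t phi) / 2, tau = s + i t *)
Definition dtau (t : C) (z : 'rV[C]_n) : C :=
  (Complex ('D_e_s phiR (ofC (pt t z))) 0 - iC * Complex ('D_e_t phiR (ofC (pt t z))) 0) / 2%:R.

(* d^2 phi / d tau d taubar = (d_s^2 phi + d_t^2 phi) / 4 *)
Definition ddbar (t : C) (z : 'rV[C]_n) : R :=
  ('D_e_s ('D_e_s phiR) (ofC (pt t z)) + 'D_e_t ('D_e_t phiR) (ofC (pt t z))) / 4%:R.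

Definition eMinusPhi (O : set 'rV[C]_n) (t : C) : R :=
  rintC O (fun z => expR (- phi t z)).

Definition Gfun (O : set 'rV[C]_n) (g : C -> R) (t : C) : R :=
  g t + cabs (cintC O (fun z => dtau t z * Complex (expR (- phi t z)) 0)) ^+ 2
        / (eMinusPhi O t) ^+ 2.

End Phi.

End Defs.

(* Main.v *)
Require Import Defs.
From HB Require Import structures.
From mathcomp Require Import all_boot all_order all_algebra.
From mathcomp Require Import all_classical all_reals all_analysis.
From mathcomp.real_closed Require Import complex.
From mathcomp Require Import measurable_realfun ring lra.
Set Implicit Arguments.
Unset Strict Implicit.
Unset Printing Implicit Defensive.
Import Order.TTheory GRing.Theory Num.Theory.
Import numFieldNormedType.Exports.
Local Open Scope classical_set_scope.
Local Open Scope ring_scope.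

(** Everything is done fibrewise in z, which avoids differentiating under the
integral over Omega. Take f(tau) = 1 + c (tau - a) and, for fixed z, let
H = |f|^2 e^{-phi(., z)}. With c = 0 the curvature hypothesis says that H is
superharmonic, which settles the case G(a) <= eps. Otherwise take c to be the
mean of d phi / d tau at a for the density e^{-phi(a, .)}; at tau = a the integral over
z of the (d/d tau)(d/d taubar)-derivative of H is then at most - G(a) F, with F the
integral of e^{-phi(a, .)}, and by uniform continuity up to the boundary this
persists near a, uniformly in z, up to an error eps.

The disc average of H is controlled by the C^2 mean value inequality: if
Laplacian H <= - 4 M, then int_disc H <= pi r^2 H(a) - M pi r^4 / 2. Indeed
the derivative in x of int_disc H(a + x (p - a)) dp is
int_disc (p - a) . grad H(a + x (p - a)) dp, and integrating by parts against
(r^2 - |p - a|^2) / 2, which vanishes on the circle, turns it into x times a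
weighted integral of the Laplacian. The theorem follows from 1 - x <= e^{-x}.

Iterated integrals are rearranged by Tonelli. Measurability of the partial
integrals comes for free because the integrands are lower semicontinuous, a
property which Fatou's lemma preserves under partial integration. *)

(** * Lower semicontinuous functions *)

Section lower_semicontinuity.
Variable R : realType.
Local Notation mu := (@lebesgue_measure R).

Lemma continuous_mx (T : topologicalType) (m n : nat) (f : T -> 'M[R]_(m, n)) :
  (forall i j, continuous (fun x => f x i j)) -> continuous f.
Proof.
move=> cf x A [P Pf PA].
have : \forall y \near x, forall i j, P i j (f y i j).
  apply: filter_forall => i; apply: filter_forall => j.
  exact: (cf i j x _ (Pf i j)).
by apply: filterS => y Py; exact: PA.
Qed.

Lemma continuous_pair (T U V : topologicalType) (f : T -> U) (h : T -> V) :
  continuous f -> continuous h -> continuous (fun x => (f x, h x)).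
Proof. by move=> cf ch x; apply: cvg_pair; [exact: cf|exact: ch]. Qed.

Lemma lsc_comp (T T' : topologicalType) (f : T' -> \bar R) (h : T -> T') :
  lower_semicontinuous f -> continuous h -> lower_semicontinuous (f \o h).
Proof.
move=> /lower_semicontinuousP lf ch; apply/lower_semicontinuousP => a.
by move/continuousP : ch => /(_ _ (lf a)).
Qed.

Lemma ereal_lt_dense (x y : \bar R) : (x < y)%E ->
  exists a : R, (x < a%:E)%E /\ (a%:E < y)%E.
Proof.
case: x y => [x||] [y||] //=; rewrite ?lte_fin => xy.
- by exists ((x + y) / 2); rewrite !lte_fin; split; lra.
- by exists (x + 1); rewrite ltry lte_fin; split=> //; lra.
- by exists (y - 1); rewrite ltNyr lte_fin; split=> //; lra.
- by exists 0; rewrite ltry ltNyr.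
Qed.

Lemma limn_einf_ge (u : (\bar R)^nat) (l : \bar R) :
  (forall a : R, (a%:E < l)%E -> \forall n \near \oo, (a%:E <= u n)%E) ->
  (l <= limn_einf u)%E.
Proof.
move=> ul; rewrite leNgt; apply/negP => ll.
have [a [la al]] := ereal_lt_dense ll.
have [N _ Na] := ul a al.
move: la; rewrite ltNge => /negP; apply.
rewrite limn_einf_lim; apply: lime_ge; first exact: is_cvg_einfs.
exists N => // n /= Nn; apply: le_ereal_inf_tmp => _ [k /= nk <-].
by apply: Na => /=; exact: leq_trans nk.
Qed.

Lemma limn_einf_le (u : (\bar R)^nat) (l : \bar R) :
  (forall n, (u n <= l)%E) -> (limn_einf u <= l)%E.
Proof.
move=> ul; rewrite limn_einf_lim; apply: lime_le; first exact: is_cvg_einfs.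
apply: nearW => n; apply: le_trans (ul n).
by apply: ereal_inf_lbound; exists n => /=.
Qed.

(** The integral of a nonnegative function is a supremum over the simple functions below it, and a
    simple function below [f] is also below [h]; arbitrary functions are therefore allowed. *)
Lemma le_integral_ge0 (d : measure_display) (T : measurableType d)
    (m : {measure set T -> \bar R}) (f h : T -> \bar R) :
  (forall x, (0 <= f x)%E) -> (forall x, (f x <= h x)%E) ->
  (\int[m]_x f x <= \int[m]_x h x)%E.
Proof.
move=> f0 fh; have h0 x : (0 <= h x)%E by exact: le_trans (fh x).
rewrite !ge0_integralE//; apply: ub_ereal_sup => _ [k /= kf <-]; apply: ereal_sup_ubound.
by exists k => // x; apply: le_trans (kf x) _; rewrite !patch_setT.
Qed.

Lemma lsc_section (T T' : topologicalType) (k : T * T' -> \bar R) (x : T) :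
  lower_semicontinuous k -> lower_semicontinuous (fun y => k (x, y)).
Proof.
move=> lk; apply: (@lsc_comp _ _ k (fun y => (x, y))) => //.
by apply: continuous_pair => y; [exact: cvg_cst|exact: cvg_id].
Qed.

(* Fatou's lemma along a sequence violating lower semicontinuity. *)
Lemma lsc_integral (T : pseudoMetricType R) (k : T * R -> \bar R) :
  lower_semicontinuous k -> (forall p, (0 <= k p)%E) ->
  lower_semicontinuous (fun x => (\int[mu]_y k (x, y))%E).
Proof.
move=> lk k0 x c cx; apply: contrapT => nV.
have /choice[u_ Hu] : forall n : nat, exists y, ball x n.+1%:R^-1 y /\
    ((\int[mu]_z k (y, z)) <= c%:E)%E.
  move=> n; apply: contrapT => ny; apply: nV.
  exists (ball x n.+1%:R^-1).
    by apply: nbhsx_ballx; rewrite invr_gt0 ltr0n.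
  by move=> y xy; rewrite ltNge; apply/negP => ?; apply: ny; exists y.
have ux : u_ @ \oo --> x.
  apply/cvg_ballP => e e0.
  near=> n; apply: le_ball (proj1 (Hu n)); apply: ltW.
  by near: n; exact: (near_infty_natSinv_lt (PosNum e0)).
move: cx; rewrite ltNge => /negP; apply.
have := @fatou _ _ _ mu setT measurableT (fun n y => k (u_ n, y)).
move=> H; apply: le_trans (le_trans (H _ _) _).
- apply: le_integral_ge0 => // y; apply: limn_einf_ge => a ak.
  have [V nV' Va] := lk (x, y) a ak.
  have : (fun n => (u_ n, y)) @ \oo --> (x, y).
    by apply: (@cvg_pair _ _ _ \oo (nbhs x) (nbhs y) _ _ _ u_ (fun=> y)) => //; exact: cvg_cst.
  move=> /(_ _ nV') [N _ NV]; exists N => // n Nn.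
  exact/ltW/Va/NV.
- by move=> n; apply: lower_semicontinuous_measurable; exact: lsc_section.
- by move=> n y _; exact: k0.
- by apply: limn_einf_le => n; have [] := Hu n.
Unshelve. all: by end_near. Qed.

(** Links the topology of the plane to the product sigma-algebra: an open set is the union of the
    countably many rational squares that it contains. *)
Lemma open_prod_measurable (A : set (R * R)) : open A ->
  measurable (A : set (measurableTypeR R * measurableTypeR R)%type).
Proof.
move=> oA.
pose B (q : rat * rat * rat) : set (R * R) :=
  ball (ratr q.1.1 : R) (ratr q.2) `*` ball (ratr q.1.2 : R) (ratr q.2).
pose B' q := if `[< B q `<=` A >] then B q else set0.
suff -> : A = \bigcup_q B' q.
  apply: countable_bigcupT_measurable => [|q].
    exact: countableP.
  rewrite /B'; case: ifP => // _.
  by apply: measurableX; exact: measurable_ball.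
apply/seteqP; split=> [[x y] Axy|p [q _]]; last first.
  by rewrite /B'; case: ifPn => // /asboolP; exact.
have /nbhs_ballP[e /= e0 eA] := open_nbhs_nbhs (conj oA Axy).
(* With rational coordinates chosen within [d] of [(x, y)], every point of the square of radius [d]
   around them is within [2 * d < e] of [(x, y)]. *)
have [d] := @rat_in_itvoo R 0 (e / 2) (divr_gt0 e0 (ltr0Sn _ 1)).
rewrite in_itv/= => /andP[d0 de].
have [p] := @rat_in_itvoo R (x - ratr d) (x + ratr d) ltac:(lra).
rewrite in_itv/= => /andP[p1 p2].
have [q] := @rat_in_itvoo R (y - ratr d) (y + ratr d) ltac:(lra).
rewrite in_itv/= => /andP[q1 q2].
have Bxy : B (p, q, d) (x, y).
  by split; rewrite /ball/= ltr_distl/=; apply/andP; split; lra.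
exists (p, q, d) => //; rewrite /B' ifT//; apply/asboolP => -[x' y'] [].
rewrite /ball/= !ltr_distl/= => /andP[? ?] /andP[? ?]; apply: eA.
by split; rewrite /ball/= ltr_distl/=; apply/andP; split; lra.
Qed.

Lemma lsc_prod_measurable (k : R * R -> \bar R) : lower_semicontinuous k ->
  measurable_fun setT
    (k : (measurableTypeR R * measurableTypeR R)%type -> \bar R).
Proof.
move=> /lower_semicontinuousP lk.
apply: (measurability _ (ErealGenOInfty.measurableE R)).
move=> _ [_ [a ->] <-]; rewrite setTI; apply: open_prod_measurable.
by rewrite preimage_itvoy; exact: lk.
Qed.

Lemma lsc_tonelli (k : R * R -> \bar R) : lower_semicontinuous k ->
  (forall p, (0 <= k p)%E) ->
  (\int[mu]_x \int[mu]_y k (x, y) = \int[mu]_y \int[mu]_x k (x, y))%E.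
Proof.
move=> lk k0; apply: (@fubini_tonelli _ _ _ _ _ mu mu k) => //.
exact: lsc_prod_measurable.
Qed.

End lower_semicontinuity.

(** * Iterated integrals *)

Section iterated_integral.
Variable R : realType.
Local Notation mu := (@lebesgue_measure R).

Lemma continuous_row_mx (T : topologicalType) (m n : nat)
    (f : T -> 'rV[R]_m) (h : T -> 'rV[R]_n) :
  continuous f -> continuous h -> continuous (fun x => row_mx (f x) (h x)).
Proof.
move=> cf ch; apply: continuous_mx => i j.
case: (splitP j) => k jk.
  have -> : j = lshift n k by exact: val_inj.
  under eq_fun do rewrite row_mxEl.
  by move=> x; apply: (@continuous_comp _ _ _ f (fun M : 'rV_m => M i k) x (cf x));
    exact: coord_continuous.
have -> : j = rshift m k by exact: val_inj.
under eq_fun do rewrite row_mxEr.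
by move=> x; apply: (@continuous_comp _ _ _ h (fun M : 'rV_n => M i k) x (ch x));
  exact: coord_continuous.
Qed.

Lemma continuous_row1 (T : topologicalType) (f : T -> R) :
  continuous f -> continuous (fun x => \row_(_ < 1) f x).
Proof.
by move=> cf; apply: continuous_mx => i j; under eq_fun do rewrite mxE.
Qed.

Lemma eq_iint m (h k : 'rV[R]_m -> \bar R) : h =1 k -> iint h = iint k.
Proof. by move=> /funext ->. Qed.

Lemma iint_ge0 m (h : 'rV[R]_m -> \bar R) :
  (forall v, (0 <= h v)%E) -> (0 <= iint h)%E.
Proof.
elim: m h => [|m IH] h h0 //=.
by apply: integral_ge0 => x _; exact: IH.
Qed.

Lemma iint0 m : iint (fun _ : 'rV[R]_m => 0%E) = 0%E.
Proof. by elim: m => [|m IH] //=; under eq_integral do rewrite IH; exact: integral0. Qed.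

Lemma le_iint m (h k : 'rV[R]_m -> \bar R) : (forall v, (0 <= h v)%E) ->
  (forall v, (h v <= k v)%E) -> (iint h <= iint k)%E.
Proof.
elim: m h k => [|m IH] h k h0 hk //=.
apply: le_integral_ge0 => x; first exact: iint_ge0.
exact: IH.
Qed.

(** The parameter space [T] is general so that the induction can absorb the first coordinate into
    it, passing from [T] to [T * R]; [lsc_integral] then integrates that coordinate out. *)
Lemma lsc_iint m (T : pseudoMetricType R) (k : T * 'rV[R]_m -> \bar R) :
  lower_semicontinuous k -> (forall p, (0 <= k p)%E) ->
  lower_semicontinuous (fun x => iint (fun y => k (x, y))).
Proof.
elim: m T k => [|m IH] T k lk k0 /=.
  apply: (@lsc_comp _ _ _ k (fun x => (x, 0))) => //.
  by apply: continuous_pair => x; [exact: cvg_id|exact: cvg_cst].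
pose k' (p : (T * R) * 'rV[R]_m) := k (p.1.1, row_mx (\row_(_ < 1) p.1.2) p.2).
have lk' : lower_semicontinuous k'.
  apply: (@lsc_comp _ _ _ k
    (fun p : (T * R) * 'rV[R]_m => (p.1.1, row_mx (\row_(_ < 1) p.1.2) p.2 : 'rV_(1 + m)))) => //.
  apply: continuous_pair => [p|].
    by apply: (@cvg_comp _ _ _ fst fst); exact: cvg_fst.
  apply: (@continuous_row_mx _ 1 m (fun p => \row_(_ < 1) p.1.2) snd);
    last by move=> ?; exact: cvg_snd.
  apply: continuous_row1 => q.
  by apply: (@cvg_comp _ _ _ fst snd); [exact: cvg_fst|exact: cvg_snd].
apply: (@lsc_integral _ _ (fun q => iint (fun y => k' (q, y)))) => [|p].
  by apply: IH => // p; exact: k0.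
by apply: iint_ge0 => y; exact: k0.
Qed.

Lemma lsc_iint_cons m (h : 'rV[R]_m.+1 -> \bar R) : lower_semicontinuous h ->
  (forall v, (0 <= h v)%E) ->
  lower_semicontinuous (fun x : R =>
    iint (fun y : 'rV[R]_m => h (row_mx (\row_(_ < 1) x) y))).
Proof.
move=> lh h0.
apply: (@lsc_iint m _
  (fun p : R * 'rV_m => h (row_mx (\row_(_ < 1) p.1) p.2))) => //.
apply: (@lsc_comp _ _ _ h
  (fun p : R * 'rV_m => row_mx (\row_(_ < 1) p.1) p.2 : 'rV_(1 + m))) => //.
apply: (@continuous_row_mx _ 1 m (fun p => \row_(_ < 1) p.1) snd);
  last by move=> ?; exact: cvg_snd.
by apply: continuous_row1 => ?; exact: cvg_fst.
Qed.

Lemma lsc_cons_section m (h : 'rV[R]_m.+1 -> \bar R) (x : R) :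
  lower_semicontinuous h ->
  lower_semicontinuous (fun y : 'rV[R]_m => h (row_mx (\row_(_ < 1) x) y)).
Proof.
move=> lh; apply: (@lsc_comp _ _ _ h
  (fun y => row_mx (\row_(_ < 1) x) y : 'rV_(1 + m))) => //.
apply: (@continuous_row_mx _ 1 m (fun=> \row_(_ < 1) x) id).
  exact: cst_continuous.
by move=> ?; exact: cvg_id.
Qed.

(** Tonelli moves the integral in [x] past the first coordinate of [y], and the induction hypothesis
    moves it past the remaining ones. *)
Lemma iint_swap m (k : R * 'rV[R]_m -> \bar R) :
  lower_semicontinuous k -> (forall p, (0 <= k p)%E) ->
  (\int[mu]_x iint (fun y => k (x, y)) = iint (fun y => \int[mu]_x k (x, y)))%E.
Proof.
elim: m k => [|m IH] k lk k0 //=.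
have cq (T : topologicalType) (f : T -> R) (h : T -> R) (z : T -> 'rV[R]_m) :
    continuous f -> continuous h -> continuous z ->
    lower_semicontinuous (fun t => k (f t, row_mx (\row_(_ < 1) h t) (z t))).
  move=> cf ch cz; apply: (@lsc_comp _ _ _ k
    (fun t => (f t, row_mx (\row_(_ < 1) h t) (z t) : 'rV_(1 + m)))) => //.
  apply: continuous_pair; first exact: cf.
  apply: (@continuous_row_mx _ 1 m (fun t => \row_(_ < 1) h t) z) => //.
  exact: continuous_row1.
rewrite (lsc_tonelli (k := fun p => iint (fun y =>
    k (p.1, row_mx (\row_(_ < 1) p.2) y)))).
- apply: eq_integral => s _.
  apply: (IH (fun p => k (p.1, row_mx (\row_(_ < 1) s) p.2))) => //.
  by apply: cq => [?|?|?]; [exact: cvg_fst|exact: cvg_cst|exact: cvg_snd].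
- apply: (@lsc_iint m _ (fun q : (R * R) * 'rV_m =>
    k (q.1.1, row_mx (\row_(_ < 1) q.1.2) q.2))) => //.
  apply: cq => q; last exact: cvg_snd.
    by apply: (@cvg_comp _ _ _ fst fst); exact: cvg_fst.
  by apply: (@cvg_comp _ _ _ fst snd); [exact: cvg_fst|exact: cvg_snd].
- by move=> p; apply: iint_ge0.
Qed.

Lemma iintD m (h k : 'rV[R]_m -> \bar R) :
  lower_semicontinuous h -> lower_semicontinuous k ->
  (forall v, (0 <= h v)%E) -> (forall v, (0 <= k v)%E) ->
  (iint (fun v => h v + k v) = iint h + iint k)%E.
Proof.
elim: m h k => [|m IH] h k lh lk h0 k0 //=.
rewrite -ge0_integralD//.
- by apply: eq_integral => x _; apply: IH => //; exact: lsc_cons_section.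
- by move=> x _; apply: iint_ge0.
- by apply: lower_semicontinuous_measurable; exact: lsc_iint_cons.
- by move=> x _; apply: iint_ge0.
- by apply: lower_semicontinuous_measurable; exact: lsc_iint_cons.
Qed.

Lemma iintZ m (c : R) (h : 'rV[R]_m -> \bar R) : 0 <= c ->
  lower_semicontinuous h -> (forall v, (0 <= h v)%E) ->
  (iint (fun v => c%:E * h v) = c%:E * iint h)%E.
Proof.
move=> c0; elim: m h => [|m IH] h lh h0 //=.
rewrite -ge0_integralZl//.
- by apply: eq_integral => x _; apply: IH => //; exact: lsc_cons_section.
- by apply: lower_semicontinuous_measurable; exact: lsc_iint_cons.
- by move=> x _; apply: iint_ge0.
Qed.

Lemma iint_cat n1 n2 (h : 'rV[R]_(n1 + n2) -> \bar R) :
  iint h = iint (fun u : 'rV[R]_n1 => iint (fun v : 'rV[R]_n2 => h (row_mx u v))).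
Proof.
elim: n1 h => [|n1 IH] h.
  by apply: eq_iint => v; rewrite row_thin_mx.
rewrite [LHS]/= [RHS]/=; apply: eq_integral => x _.
rewrite (IH (fun y => h (row_mx (\row_(_ < 1) x) y))).
apply: eq_iint => u; apply: eq_iint => v; congr h.
by rewrite (@row_mxA _ 1 1 n1 n2); exact: castmx_id.
Qed.

End iterated_integral.

(** * Integrals of continuous functions on bounded open sets *)

Section integral_on_open_sets.
Variable R : realType.
Local Notation mu := (@lebesgue_measure R).

(* The real coordinates (Re tau, Re z, Im tau, Im z) of (tau, z), in the order
   used by [toC]; [y] lists (Re z, Im z). *)
Definition tzvec (n : nat) (s t : R) (y : 'rV[R]_(n + n)) :
    'rV[R]_((1 + n) + (1 + n)) :=
  row_mx (row_mx (\row_(_ < 1) s) (lsubmx y)) (row_mx (\row_(_ < 1) t) (rsubmx y)).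

Lemma continuous_tzvec (T : topologicalType) (n : nat) (f h : T -> R)
    (z : T -> 'rV[R]_(n + n)) : continuous f -> continuous h -> continuous z ->
  continuous (fun x => tzvec (f x) (h x) (z x)).
Proof.
move=> cf ch cz.
have cl : continuous (fun x => lsubmx (z x)).
  apply: continuous_mx => i j; under eq_fun do rewrite mxE.
  move=> x; apply: (@continuous_comp _ _ _ z (fun M : 'rV_(n + n) => M i (lshift n j)) x (cz x)).
  exact: coord_continuous.
have cr : continuous (fun x => rsubmx (z x)).
  apply: continuous_mx => i j; under eq_fun do rewrite mxE.
  move=> x; apply: (@continuous_comp _ _ _ z (fun M : 'rV_(n + n) => M i (rshift n j)) x (cz x)).
  exact: coord_continuous.
by apply: continuous_row_mx; apply: continuous_row_mx => //; exact: continuous_row1.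
Qed.

(** [iint] integrates in the order s, Re z, t, Im z. The integral in t is first pulled out past Re
    z; then those in t and s are pushed in past all of [y], which leaves a planar integral in tau
    for each fixed z. *)
Lemma iint_tzvec n (h : 'rV[R]_((1 + n) + (1 + n)) -> \bar R) :
  lower_semicontinuous h -> (forall v, (0 <= h v)%E) ->
  (iint h = iint (fun y : 'rV[R]_(n + n) =>
     \int[mu]_s \int[mu]_t h (tzvec s t y)))%E.
Proof.
move=> lh h0; rewrite iint_cat /=.
have lg (T : topologicalType) (f k : T -> R) (z : T -> 'rV[R]_(n + n)) :
    continuous f -> continuous k -> continuous z ->
    lower_semicontinuous (fun x => h (tzvec (f x) (k x) (z x))).
  move=> cf ck cz; apply: (@lsc_comp _ _ _ h (fun x => tzvec (f x) (k x) (z x))) => //.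
  exact: continuous_tzvec.
have c11 (T U V : topologicalType) : continuous (fun q : T * U * V => q.1.1).
  by move=> q; apply: (@cvg_comp _ _ _ fst fst); exact: cvg_fst.
have c12 (T U V : topologicalType) : continuous (fun q : T * U * V => q.1.2).
  by move=> q; apply: (@cvg_comp _ _ _ fst snd); [exact: cvg_fst|exact: cvg_snd].
have c1 (T U : topologicalType) : continuous (@fst T U).
  by move=> q; exact: cvg_fst.
have c2 (T U : topologicalType) : continuous (@snd T U).
  by move=> q; exact: cvg_snd.
transitivity (\int[mu]_s \int[mu]_t
    iint (fun y : 'rV[R]_(n + n) => h (tzvec s t y)))%E.
  apply: eq_integral => s _.
  rewrite -(@iint_swap _ _ (fun p : R * 'rV[R]_n => iint (fun v : 'rV[R]_n =>
    h (row_mx (row_mx (\row_(_ < 1) s) p.2) (row_mx (\row_(_ < 1) p.1) v))))) /=.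
  - apply: eq_integral => t _; rewrite [RHS]iint_cat.
    apply: eq_iint => u; apply: eq_iint => v.
    by rewrite /tzvec row_mxKl row_mxKr.
  - pose k (q : (R * 'rV[R]_n) * 'rV[R]_n) := h (tzvec s q.1.1 (row_mx q.1.2 q.2)).
    have := @lsc_iint _ _ _ k; rewrite /k /tzvec/=.
    under [X in _ -> _ -> lower_semicontinuous X]eq_fun do
      under eq_iint do rewrite row_mxKl row_mxKr.
    apply => //; apply: lg; [exact: cst_continuous|exact: c11|].
    by apply: (@continuous_row_mx _ _ n n (fun q => q.1.2) snd); [exact: c12|exact: c2].
  - by move=> p; apply: iint_ge0.
rewrite -(@iint_swap _ _ (fun p : R * 'rV[R]_(n + n) =>
  \int[mu]_t h (tzvec p.1 t p.2))%E).
- apply: eq_integral => s _ /=.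
  rewrite (@iint_swap _ _ (fun p : R * 'rV[R]_(n + n) => h (tzvec s p.1 p.2)))//.
  by apply: lg; [exact: cst_continuous|exact: c1|exact: c2].
- apply: (@lsc_integral _ _ (fun q : R * 'rV[R]_(n + n) * R =>
    h (tzvec q.1.1 q.2 q.1.2))) => //.
  by apply: lg; [exact: c11|exact: c2|exact: c12].
- by move=> p; apply: integral_ge0.
Qed.

Section bounded_continuous.
Variables (T : topologicalType) (A : set T).

(** On a bounded open [A], these functions form an algebra, and their positive and negative parts
    have finite integrals. *)
Definition bcont (p : T -> R) :=
  (forall v, A v -> {for v, continuous p}) /\
  exists K, forall v, A v -> `|p v| <= K.

Lemma bcontD p q : bcont p -> bcont q -> bcont (fun v => p v + q v).
Proof.
move=> [cp [K Kp]] [cq [L Lq]]; split.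
  by move=> v Av; apply: continuousD; [exact: cp|exact: cq].
by exists (K + L) => v Av; rewrite (le_trans (ler_normD _ _))// lerD ?Kp ?Lq.
Qed.

Lemma bcontM p q : bcont p -> bcont q -> bcont (fun v => p v * q v).
Proof.
move=> [cp [K Kp]] [cq [L Lq]]; split.
  by move=> v Av; apply: continuousM; [exact: cp|exact: cq].
by exists (K * L) => v Av; rewrite normrM ler_pM ?Kp ?Lq.
Qed.

Lemma bcont_cst c : bcont (fun=> c).
Proof. by split; [move=> v _; exact: cst_continuous|exists `|c|]. Qed.

Lemma bcont_max0 p : bcont p -> bcont (fun v => Num.max (p v) 0).
Proof.
move=> [cp [K Kp]]; split.
  move=> v Av; apply: (@continuous_max _ _ p (fun=> 0)); first exact: cp.
  exact: cst_continuous.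
exists K => v Av; apply: le_trans (Kp v Av).
by rewrite /Num.max; case: ifPn => // _; rewrite normr0.
Qed.

Lemma bcontN p : bcont p -> bcont (fun v => - p v).
Proof.
move=> [cp [K Kp]]; split; first by move=> v Av; apply: continuousN; exact: cp.
by exists K => v Av; rewrite normrN Kp.
Qed.

(** At points of the open set [A] continuity suffices; elsewhere the value is 0, which is the
    minimum of a nonnegative function. *)
Lemma lsc_indicM (p : T -> R) : open A -> (forall v, A v -> {for v, continuous p}) ->
  (forall v, A v -> 0 <= p v) -> lower_semicontinuous (fun v => (\1_A v * p v)%:E).
Proof.
move=> oA cp p0 v a; rewrite lte_fin indicE.
have [vA|vA] := boolP (v \in A); rewrite ?mul1r ?mul0r => av.
  move/set_mem in vA.
  have : \forall w \near v, A w /\ a < p w.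
    apply: filterI; first exact: open_nbhs_nbhs.
    exact: (cp v vA _ (lt_nbhsr av)).
  move=> nA; eexists; first exact: nA.
  by move=> w [Aw aw]; rewrite lte_fin indicE mem_set// mul1r.
exists setT => [|w _]; first exact: filterT.
rewrite lte_fin (lt_le_trans av)// indicE.
have [wA|] := boolP (w \in A); last by rewrite mul0r.
by rewrite mul1r p0//; exact: set_mem.
Qed.

End bounded_continuous.

Lemma bcont_comp (T T' : topologicalType) (A : set T) (A' : set T')
    (f : T' -> T) (p : T -> R) :
  continuous f -> (forall x, A' x -> A (f x)) -> bcont A p ->
  bcont A' (fun x => p (f x)).
Proof.
move=> cf ff [cp [K Kp]]; split; last by exists K => v /ff; exact: Kp.
by move=> v A'v; apply: (@continuous_comp _ _ _ f p); [exact: cf|exact/cp/ff].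
Qed.

Lemma bcontS (T : topologicalType) (A B : set T) (p : T -> R) :
  A `<=` B -> bcont B p -> bcont A p.
Proof. by move=> AB; apply: (@bcont_comp _ _ _ _ id) => // x; exact: cvg_id. Qed.


(** Gives finiteness of integrals over bounded sets: each of the [m] integrations runs over
    [[- M, M]] and costs a factor [2 * M]. *)
Lemma iint_le_box (m : nat) (h : 'rV[R]_m -> \bar R) (K M : R) : 0 <= M -> 0 <= K ->
  (forall v, (0 <= h v)%E) -> (forall v, (h v <= K%:E)%E) ->
  (forall (v : 'rV[R]_m) i, M < `|v 0 i| -> h v = 0%E) ->
  (iint h <= (K * (2 * M) ^+ m)%:E)%E.
Proof.
move=> M0 K0; elim: m h => [|m IH] h h0 hK hM /=.
  by rewrite expr0 mulr1.
apply: (@le_trans _ _ (\int[mu]_x ((K * (2 * M) ^+ m)%:E * (\1_(`[- M, M]) x)%:E))%E).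
  apply: le_integral_ge0 => x; first exact: iint_ge0.
  rewrite indicE mem_setE in_itv/= -ler_norml.
  have [xM|Mx] := leP `|x| M.
    rewrite mule1; apply: IH => // v i Mv.
    apply: (hM _ (rshift 1 i)); by rewrite (@row_mxEr _ 1 1 m).
  rewrite mule0 (@eq_iint _ _ _ (fun=> 0%E)) ?iint0// => v /=.
  by apply: (hM _ (@lshift 1 m ord0)); rewrite (@row_mxEl _ 1 1 m) mxE.
rewrite ge0_integralZl//; last 2 first.
  by apply/measurable_EFinP; exact: measurable_indic.
  by rewrite lee_fin mulr_ge0// exprn_ge0// mulr_ge0.
rewrite integral_indic// setIT -[X in (_ * X)%E]/(mu _) lebesgue_measure_itv/= lte_fin.
case: ifPn => [_|].
  rewrite EFinN -EFinB lee_fin exprSr mulrA ler_wpM2l//; last by lra.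
  by apply: mulr_ge0 => //; apply: exprn_ge0; lra.
rewrite mule0 => _; rewrite lee_fin mulr_ge0// exprn_ge0//; lra.
Qed.

Lemma ler_coord_norm (m : nat) (v : 'rV[R]_m) i : `|v 0 i| <= `|v|.
Proof.
rewrite [leRHS]/Num.norm/= mx_normrE.
exact: (le_bigmax _ (fun ij : 'I_1 * 'I_m => `|v ij.1 ij.2|) (0, i)).
Qed.

Section rint.
Variables (m : nat) (A : set 'rV[R]_m).
Hypotheses (oA : open A) (bA : bounded_set A).
Implicit Types p q f k : 'rV[R]_m -> R.

Let I p := iint (fun v => (\1_A v * p v)%:E).

(** This is [rintC] read in real coordinates, so the two agree by unfolding once the integrand is
    composed with [toC]. *)
Definition rint p : R :=
  fine (I (fun v => Num.max (p v) 0)) - fine (I (fun v => Num.max (- p v) 0)).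

Let indic_ge0 f : (forall v, A v -> 0 <= f v) ->
  forall v, (0 <= (\1_A v * f v)%:E)%E.
Proof.
move=> f0 v; rewrite lee_fin indicE.
have [vA|] := boolP (v \in A); last by rewrite mul0r.
by rewrite mul1r f0//; exact: set_mem.
Qed.

Let I_fin f : bcont A f -> (forall v, A v -> 0 <= f v) -> I f \is a fin_num.
Proof.
move=> [_ [K fK]] f0; rewrite ge0_fin_numE; last first.
  by apply: iint_ge0; exact: indic_ge0.
have [M [_ /(_ (`|M| + 1))]] := bA.
rewrite (le_lt_trans (ler_norm M)) ?ltrDl// => /(_ isT) AM.
apply: (@le_lt_trans _ _ (`|K| * (2 * (`|M| + 1)) ^+ m)%:E); last exact: ltry.
apply: iint_le_box => //.
- exact: indic_ge0.
- move=> v; rewrite lee_fin indicE.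
  have [vA|] := boolP (v \in A); last by rewrite mul0r.
  move/set_mem in vA; rewrite mul1r (le_trans (ler_norm _))//.
  by rewrite (le_trans (fK _ vA))// ler_norm.
- move=> v i vM; rewrite indicE.
  have [vA|] := boolP (v \in A); last by rewrite mul0r.
  move/set_mem in vA; move: vM; rewrite ltNge.
  by rewrite (le_trans (ler_coord_norm _ _))// AM.
Qed.

Let I_D f k : bcont A f -> bcont A k -> (forall v, A v -> 0 <= f v) ->
  (forall v, A v -> 0 <= k v) -> I (fun v => f v + k v) = (I f + I k)%E.
Proof.
move=> [cf _] [ck _] f0 k0; rewrite -iintD.
- by apply: eq_iint => v; rewrite mulrDr.
- exact: lsc_indicM.
- exact: lsc_indicM.
- exact: indic_ge0.
- exact: indic_ge0.
Qed.

Let I_eq f k : (forall v, A v -> f v = k v) -> I f = I k.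
Proof.
move=> fk; apply: eq_iint => v; rewrite !indicE.
have [vA|] := boolP (v \in A); last by rewrite !mul0r.
by rewrite fk//; exact: set_mem.
Qed.

Let I_max_fin p : bcont A (fun v => Num.max (p v) 0) ->
  I (fun v => Num.max (p v) 0) \is a fin_num.
Proof. by move=> bp; apply: I_fin => // v _; rewrite le_max lexx orbT. Qed.

Let max_ge0 (x : R) : 0 <= Num.max x 0. Proof. by rewrite le_max lexx orbT. Qed.

(** Any splitting of [p] into nonnegative parts computes the integral: adding [k] to the positive
    part of [p] equals adding the negative part of [p] to [f], and all four integrals are finite.
    Linearity of [rint] follows from suitable splittings. *)
Lemma rintE p f k : bcont A p -> bcont A f -> bcont A k ->
  (forall v, A v -> 0 <= f v) -> (forall v, A v -> 0 <= k v) ->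
  (forall v, A v -> p v = f v - k v) -> rint p = fine (I f) - fine (I k).
Proof.
move=> bp bf bk f0 k0 pE.
have bp' := bcont_max0 bp; have bn' := bcont_max0 (bcontN bp).
have := @I_D _ _ bp' bk (fun v _ => max_ge0 (p v)) k0.
have -> : I (fun v => Num.max (p v) 0 + k v) = I (fun v => f v + Num.max (- p v) 0).
  apply: I_eq => v Av; move: (pE v Av) => {}pE.
  by rewrite /Num.max; case: ifPn; case: ifPn; rewrite ?oppr_lt0 -?leNgt; lra.
rewrite (I_D bf bn' f0 (fun v _ => max_ge0 (- p v))) => /(congr1 fine).
rewrite (fineD (I_fin bf f0) (@I_max_fin (fun v => - p v) bn')).
by rewrite (fineD (@I_max_fin p bp') (I_fin bk k0)) /rint => E; lra.
Qed.

Lemma rint_ge0E f : bcont A f -> (forall v, A v -> 0 <= f v) ->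
  I f = (rint f)%:E.
Proof.
move=> bf f0; rewrite (@rintE f f (fun=> 0))//; last 2 first.
  exact: bcont_cst.
  by move=> v _; rewrite subr0.
have -> : I (fun=> 0) = 0%E.
  by rewrite -[RHS](@iint0 R m); apply: eq_iint => v; rewrite mulr0.
by rewrite subr0 fineK// I_fin.
Qed.

Lemma rintD p q : bcont A p -> bcont A q ->
  rint (fun v => p v + q v) = rint p + rint q.
Proof.
move=> bp bq.
have bp' := bcont_max0 bp; have bn' := bcont_max0 (bcontN bp).
have bq' := bcont_max0 bq; have bm' := bcont_max0 (bcontN bq).
rewrite (@rintE _ (fun v => Num.max (p v) 0 + Num.max (q v) 0)
  (fun v => Num.max (- p v) 0 + Num.max (- q v) 0)).
- rewrite (I_D bp' bq' (fun v _ => max_ge0 (p v)) (fun v _ => max_ge0 (q v))).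
  rewrite (I_D bn' bm' (fun v _ => max_ge0 (- p v))
    (fun v _ => max_ge0 (- q v))).
  rewrite (fineD (@I_max_fin p bp') (@I_max_fin q bq')).
  rewrite (fineD (@I_max_fin (fun v => - p v) bn') (@I_max_fin (fun v => - q v) bm')).
  by rewrite /rint; lra.
- exact: bcontD.
- exact: bcontD.
- exact: bcontD.
- by move=> v _; rewrite addr_ge0 ?max_ge0.
- by move=> v _; rewrite addr_ge0 ?max_ge0.
- by move=> v _; rewrite /Num.max; do 4 case: ifPn; rewrite ?oppr_lt0 -?leNgt; lra.
Qed.

Let I_Z (c : R) f : 0 <= c -> bcont A f -> (forall v, A v -> 0 <= f v) ->
  I (fun v => c * f v) = (c%:E * I f)%E.
Proof.
move=> c0 [cf _] f0; rewrite -iintZ//.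
- by apply: eq_iint => v; rewrite mulrCA.
- exact: lsc_indicM.
- exact: indic_ge0.
Qed.

Lemma rintZ (c : R) p : bcont A p -> rint (fun v => c * p v) = c * rint p.
Proof.
move=> bp; have bc c' := bcont_cst A c'.
have bp' := bcont_max0 bp; have bn' := bcont_max0 (bcontN bp).
have [c0|c0] := leP 0 c.
  rewrite (@rintE _ (fun v => c * Num.max (p v) 0) (fun v => c * Num.max (- p v) 0)).
  - rewrite (I_Z c0 bp' (fun v _ => max_ge0 (p v))).
    rewrite (I_Z c0 bn' (fun v _ => max_ge0 (- p v))).
    rewrite (fineM _ (@I_max_fin p bp'))// (fineM _ (@I_max_fin (fun v => - p v) bn'))//.
    by rewrite -mulrBr.
  - exact: bcontM.
  - exact: bcontM.
  - exact: bcontM.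
  - by move=> v _; rewrite mulr_ge0 ?max_ge0.
  - by move=> v _; rewrite mulr_ge0 ?max_ge0.
  - move=> v _; rewrite -mulrBr; congr (c * _).
    by rewrite /Num.max; do 2 case: ifPn; rewrite ?oppr_lt0 -?leNgt; lra.
(* For negative [c] the positive and negative parts of [p] exchange roles. *)
have Nc0 : 0 <= - c by lra.
rewrite (@rintE _ (fun v => - c * Num.max (- p v) 0) (fun v => - c * Num.max (p v) 0)).
- rewrite (I_Z Nc0 bp' (fun v _ => max_ge0 (p v))).
  rewrite (I_Z Nc0 bn' (fun v _ => max_ge0 (- p v))).
  rewrite (fineM _ (@I_max_fin p bp'))// (fineM _ (@I_max_fin (fun v => - p v) bn'))//.
  by rewrite /rint /=; lra.
- exact: bcontM.
- exact: bcontM.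
- exact: bcontM.
- by move=> v _; rewrite mulr_ge0 ?max_ge0.
- by move=> v _; rewrite mulr_ge0 ?max_ge0.
- move=> v _; rewrite -mulrBr mulNr -mulrN; congr (c * _).
  by rewrite /Num.max; do 2 case: ifPn; rewrite ?oppr_lt0 -?leNgt; lra.
Qed.

End rint.

End integral_on_open_sets.

(** * Integration by parts and mean value inequality on discs *)

Section chords.
Variable R : realType.
Local Notation mu := (@lebesgue_measure R).

Lemma sqr_lt_itv (c w : R) : 0 < w ->
  [set x | (x - c) ^+ 2 < w ^+ 2] = `]c - w, c + w[%classic.
Proof.
move=> w0; apply/seteqP; split => x /=; rewrite in_itv/= => H.
  apply/andP; split; nra.
by move/andP: H => [? ?]; nra.
Qed.

(* The integrand is the derivative of - (w^2 - (x - c)^2) / 2 * g x, which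
   vanishes at both ends of the chord. *)
Lemma chord_by_parts (c w : R) (g dg : R -> R) : 0 < w ->
  (forall x, (x - c) ^+ 2 <= w ^+ 2 -> is_derive x 1 g (dg x)) ->
  (forall x, (x - c) ^+ 2 <= w ^+ 2 -> {for x, continuous dg}) ->
  (\int[mu]_(x in ([set x | (x - c) ^+ 2 < w ^+ 2] : set R)%R)
     ((x - c) * g x - (w ^+ 2 - (x - c) ^+ 2) / 2 * dg x)%:E = 0)%E.
Proof.
move=> w0 dG cdG; rewrite sqr_lt_itv//.
have ab : c - w < c + w by lra.
have inw x : x \in `[c - w, c + w] -> (x - c) ^+ 2 <= w ^+ 2.
  by rewrite in_itv/= => /andP[? ?]; nra.
pose F := (fun x : R => - ((w ^+ 2 - (x - c) ^+ 2) / 2)) * g.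
pose f x := (x - c) * g x - (w ^+ 2 - (x - c) ^+ 2) / 2 * dg x.
have dF x : x \in `[c - w, c + w] -> is_derive x 1 F (f x).
  move=> /inw xw; have ? := dG x xw.
  have P : is_derive x 1 (fun x : R => - ((w ^+ 2 - (x - c) ^+ 2) / 2)) (x - c).
    apply: is_derive_eq.
    by rewrite /GRing.scale/=; lra.
  have := is_deriveM P (dG x xw); rewrite -/F => H.
  by apply: is_derive_eq; rewrite /f /GRing.scale/=; lra.
have cf x : x \in `[c - w, c + w] -> {for x, continuous f}.
  move=> /inw xw.
  have cg : {for x, continuous g}.
    by apply: differentiable_continuous; apply/derivable1_diffP; have [] := dG x xw.
  have cx : {for x, continuous (fun y : R => y - c)}.
    by apply: continuousB => //; exact: cst_continuous.
  apply: continuousB; first exact: continuousM.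
  apply: continuousM; last exact: cdG.
  apply: continuousM; last exact: cst_continuous.
  apply: continuousB; first exact: cst_continuous.
  exact: continuousM.
have cF x : x \in `[c - w, c + w] -> {for x, continuous F}.
  move=> xw; apply: differentiable_continuous; apply/derivable1_diffP.
  by have [] := dF x xw.
have F0 x : (x - c) ^+ 2 = w ^+ 2 -> F x = 0.
  move=> xw; rewrite /F -[LHS]/(- ((w ^+ 2 - (x - c) ^+ 2) / 2) * g x) xw.
  by rewrite subrr mul0r oppr0 mul0r.
have oc x : x \in `]c - w, c + w[ -> x \in `[c - w, c + w].
  by rewrite !in_itv/= => /andP[? ?]; apply/andP; split; exact: ltW.
rewrite -(@integral_itv_bndoo _ _ _ _ true false).
- rewrite (@continuous_FTC2 _ f F)//.
  + by rewrite !F0 ?subee//; ring.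
  + by apply: continuous_in_subspaceT => x /set_mem/= xw; exact: cf.
  + split.
    * by move=> x /oc xw; have [] := dF x xw.
    * by apply: cvg_at_right_filter; apply: cF; rewrite in_itv/= lexx ltW.
    * by apply: cvg_at_left_filter; apply: cF; rewrite in_itv/= lexx ltW.
  + move=> x /oc xw; rewrite derive1E; apply: derive_val; exact: dF.
- apply/measurable_EFinP; apply: open_continuous_measurable_fun => //.
  by move=> x /set_mem/= /oc; exact: cf.
Qed.

End chords.

(** * Area under a semicircle *)

Section disc_area.
Variable R : realType.
Local Notation mu := (@lebesgue_measure R).

(** The substitution x = c + r sin u turns the integrand into 2 r^2 cos^2 u on [- pi/2, pi/2], with
    primitive r^2 (u + sin u cos u). *)
Lemma integral_semicircle (c r : R) : 0 < r ->
  (\int[mu]_(x in ([set x | (x - c) ^+ 2 < r ^+ 2] : set R)%R)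
     (2 * Num.sqrt (r ^+ 2 - (x - c) ^+ 2))%:E = (pi * r ^+ 2)%:E)%E.
Proof.
move=> r0; rewrite sqr_lt_itv//.
pose F : R -> R := fun x => c + r * sin x.
pose G : R -> R := fun x => 2 * Num.sqrt (r ^+ 2 - (x - c) ^+ 2).
have cG : continuous G.
  move=> x; rewrite /G; apply: cvgM; first exact: cvg_cst.
  apply: (@continuous_comp _ _ _ (fun x => r ^+ 2 - (x - c) ^+ 2) Num.sqrt);
    last exact: sqrt_continuous.
  apply: continuousB; first exact: cst_continuous.
  have cx : {for x, continuous (fun y : R => y - c)}.
    by apply: continuousB => //; exact: cst_continuous.
  exact: continuousM.
have dF (x : R) : is_derive x 1 F (r * cos x).
  by apply: is_derive_eq; rewrite /GRing.scale/=; ring.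
have F'E : F^`()%classic = (fun x => r * cos x).
  by apply/funext => x; rewrite derive1E; apply: derive_val; exact: dF.
have cF : continuous F.
  move=> x; apply: differentiable_continuous; apply/derivable1_diffP.
  by have [] := dF x.
have cF' : continuous F^`()%classic.
  rewrite F'E => x; apply: cvgM; first exact: cvg_cst.
  exact: continuous_cos.
have pi0 : - (pi / 2) < pi / 2 :> R by have := pi_gt0 R; lra.
have Fb : F (pi / 2) = c + r by rewrite /F sin_pihalf mulr1.
have Fa : F (- (pi / 2)) = c - r by rewrite /F sinN sin_pihalf mulrN1.
rewrite -(@integral_itv_bndoo _ _ _ _ true false); last first.
  by apply/measurable_EFinP; apply: open_continuous_measurable_fun.
rewrite -Fa -Fb (@integration_by_substitution_increasing _ F G); last 7 first.
- exact: ltW.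
- move=> x y xp yp xy; rewrite /F ltrD2l ltr_pM2l//.
  by rewrite ltr_sin.
- by move=> x _; exact: cF'.
- by apply/cvg_ex; eexists; apply: cvg_at_right_filter; exact: cF'.
- by apply/cvg_ex; eexists; apply: cvg_at_left_filter; exact: cF'.
- split; first by move=> x _; have [] := dF x.
    by apply: cvg_at_right_filter; exact: cF.
  by apply: cvg_at_left_filter; exact: cF.
- by apply: continuous_subspaceT.
pose f : R -> R := fun x => 2 * r ^+ 2 * cos x ^+ 2.
pose P : R -> R := fun x => r ^+ 2 * (x + sin x * cos x).
have dP (x : R) : is_derive x 1 P (f x).
  apply: is_derive_eq; rewrite /GRing.scale/= /f.
  by have := cos2Dsin2 x; nra.
transitivity (\int[mu]_(x in `[(- (pi / 2))%R, (pi / 2)%R]) (f x)%:E)%E.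
  apply: eq_integral => x /set_mem/=; rewrite in_itv/= => xp.
  rewrite F'E /f; congr EFin.
  rewrite -[LHS]/(2 * Num.sqrt (r ^+ 2 - (F x - c) ^+ 2) * (r * cos x)).
  have -> : r ^+ 2 - (F x - c) ^+ 2 = (r * cos x) ^+ 2.
    by rewrite /F; have := cos2Dsin2 x; nra.
  rewrite sqrtr_sqr ger0_norm; first by ring.
  by rewrite mulr_ge0 ?(ltW r0)//; exact: cos_ge0_pihalf.
rewrite (@continuous_FTC2 _ f P)//.
- rewrite /P cosN cos_pihalf -EFinB; congr EFin; lra.
- apply: continuous_subspaceT => x; apply: cvgM; first exact: cvg_cst.
  by apply: cvgM; exact: continuous_cos.
- have cP : continuous P.
    move=> x; apply: differentiable_continuous; apply/derivable1_diffP.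
    by have [] := dP x.
  split; first by move=> x _; have [] := dP x.
    by apply: cvg_at_right_filter; exact: cP.
  by apply: cvg_at_left_filter; exact: cP.
- by move=> x _; rewrite derive1E; apply: derive_val; exact: dP.
Qed.

End disc_area.

(** * Integration over planar discs *)

Section disc_integrals.
Variable R : realType.
Local Notation mu := (@lebesgue_measure R).
Local Notation R2 := (measurableTypeR R * measurableTypeR R)%type.
Local Notation mu2 := (@lebesgue_measure R \x @lebesgue_measure R)%E.

Lemma continuous_open_measurable2 (D : set (R * R)) (h : R * R -> R) :
  open D -> (forall p, D p -> {for p, continuous h}) ->
  measurable_fun (D : set R2) (h : R2 -> R).
Proof.
move=> oD ch; apply: (measurability _ (RGenOInfty.measurableE R)).
move=> _ [_ [a ->] <-]; apply: open_prod_measurable.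
rewrite openE => p [Dp]; rewrite /= in_itv/= andbT => ap.
apply: filterI; first exact: open_nbhs_nbhs.
have := ch p Dp _ (lt_nbhsr ap).
by apply: filterS => q /=; rewrite in_itv/= andbT.
Qed.

Variables a1 a2 : R.

Definition rdisc (r : R) : set (R * R) :=
  [set p | (p.1 - a1) ^+ 2 + (p.2 - a2) ^+ 2 < r ^+ 2].

Let cfst : continuous (fun p : R * R => p.1 - a1).
Proof. by move=> p; apply: cvgB; [exact: cvg_fst|exact: cvg_cst]. Qed.

Let csnd : continuous (fun p : R * R => p.2 - a2).
Proof. by move=> p; apply: cvgB; [exact: cvg_snd|exact: cvg_cst]. Qed.

Lemma open_rdisc r : open (rdisc r).
Proof.
have c : continuous (fun p : R * R => (p.1 - a1) ^+ 2 + (p.2 - a2) ^+ 2).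
  by move=> p; apply: cvgD; apply: cvgM; (exact: cfst || exact: csnd).
move/continuousP : c => /(_ _ (@open_lt _ (r ^+ 2))).
exact.
Qed.

Lemma measurable_rdisc r : measurable (rdisc r : set R2).
Proof. by apply: open_prod_measurable; exact: open_rdisc. Qed.

(** By Tonelli: the slice at abscissa [s] is either empty or an interval whose length is the
    integrand of [integral_semicircle]. *)
Lemma rdisc_area r : 0 < r -> mu2 (rdisc r) = (pi * r ^+ 2)%:E.
Proof.
move=> r0; have mD := measurable_rdisc r.
rewrite -[in LHS](setIT (rdisc r)) -(integral_indic mu2 measurableT mD).
rewrite fubini_tonelli1//; last by apply/measurable_EFinP; exact: measurable_indic.
rewrite -(integral_semicircle a1 r0) [RHS]integral_mkcond.
apply: eq_integral => s _; rewrite epatch_indic/= /fubini_F.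
pose A : set R := [set t | (s - a1) ^+ 2 + (t - a2) ^+ 2 < r ^+ 2].
transitivity (\int[mu]_t (\1_A t)%:E)%E; first exact: eq_integral.
rewrite indicE; have [sr|sr] := ltP ((s - a1) ^+ 2) (r ^+ 2).
  rewrite mem_set//= mule1.
  pose w := Num.sqrt (r ^+ 2 - (s - a1) ^+ 2).
  have w0 : 0 < w by rewrite sqrtr_gt0 subr_gt0.
  have -> : A = `]a2 - w, a2 + w[%classic.
    rewrite -sqr_lt_itv//; apply/seteqP; split => t; rewrite /A/= sqr_sqrtr; lra.
  rewrite integral_indic// setIT -[LHS]/(mu _) lebesgue_measure_itv/= lte_fin.
  rewrite ifT; last by lra.
  by rewrite -EFinB -/w; congr EFin; lra.
rewrite memNset ?mule0//=; last by apply/negP; rewrite -leNgt.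
have -> : A = set0.
  by apply/seteqP; split => t //=; rewrite /A/=; have := sqr_ge0 (t - a2); lra.
by under eq_integral do rewrite indic0; rewrite integral0.
Qed.

Lemma rdisc_integrable r (h : R * R -> R) : 0 < r -> bcont (rdisc r) h ->
  mu2.-integrable (rdisc r : set R2) (EFin \o h).
Proof.
move=> r0 [ch [K hK]]; apply: measurable_bounded_integrable.
- exact: measurable_rdisc.
- by apply: le_lt_trans (ltry (pi * r ^+ 2)); rewrite -rdisc_area.
- by apply: continuous_open_measurable2 => //; exact: open_rdisc.
- exists K; split; first exact: num_real.
  by move=> M KM p /hK; move/ltW: KM => KM /le_trans; exact.
Qed.

(** Both orders are recorded because integration by parts in one variable needs the inner integral
    to run along chords in that variable. *)
Lemma rdisc_fubini r (h : R * R -> R) : 0 < r -> bcont (rdisc r) h ->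
  (\int[mu]_s \int[mu]_t (\1_(rdisc r) (s, t) * h (s, t))%:E =
   \int[mu2]_(p in rdisc r) (h p)%:E)%E /\
  (\int[mu]_t \int[mu]_s (\1_(rdisc r) (s, t) * h (s, t))%:E =
   \int[mu2]_(p in rdisc r) (h p)%:E)%E.
Proof.
move=> r0 bh.
have E : (EFin \o h) \_ (rdisc r) = (fun p => (\1_(rdisc r) p * h p)%:E).
  by apply/funext => p; rewrite epatch_indic/= -EFinM mulrC.
have := rdisc_integrable r0 bh.
move=> /(integrable_mkcond _ (measurable_rdisc r)); rewrite E => ih.
by split; rewrite [RHS]integral_mkcond E;
  [exact: (integral12_prod_meas1 ih)|exact: (integral21_prod_meas1 ih)].
Qed.

End disc_integrals.

(** * Mean value inequality *)

Section mean_value.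
Variable R : realType.
Local Notation mu := (@lebesgue_measure R).
Local Notation R2 := (measurableTypeR R * measurableTypeR R)%type.
Local Notation mu2 := (@lebesgue_measure R \x @lebesgue_measure R)%E.

(** The line at height [t] either misses the open disc or meets it in a chord whose half-length w
    satisfies w^2 = r^2 - (t - b)^2, where [chord_by_parts] applies. Regularity is asked on the
    closed disc in order to cover the end points of the chord. *)
Lemma chord_section (r c b t : R) (g dg : R -> R) : 0 < r ->
  (forall x, (x - c) ^+ 2 + (t - b) ^+ 2 <= r ^+ 2 -> is_derive x 1 g (dg x)) ->
  (forall x, (x - c) ^+ 2 + (t - b) ^+ 2 <= r ^+ 2 -> {for x, continuous dg}) ->
  (\int[mu]_x (\1_[set x : R | (x - c) ^+ 2 + (t - b) ^+ 2 < r ^+ 2]%R x *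
    ((x - c) * g x - (r ^+ 2 - (x - c) ^+ 2 - (t - b) ^+ 2) / 2 * dg x))%:E = 0)%E.
Proof.
move=> r0 dG cG.
have [tr|tr] := ltP ((t - b) ^+ 2) (r ^+ 2); last first.
  rewrite (@eq_integral _ _ _ _ _ (fun=> 0%E)) ?integral0// => x _.
  rewrite indicE memNset ?mul0r//=.
  by have := sqr_ge0 (x - c); lra.
pose w := Num.sqrt (r ^+ 2 - (t - b) ^+ 2).
have w0 : 0 < w by rewrite sqrtr_gt0 subr_gt0.
have w2 : w ^+ 2 = r ^+ 2 - (t - b) ^+ 2 by rewrite sqr_sqrtr; lra.
have H1 x : (x - c) ^+ 2 <= w ^+ 2 -> is_derive x 1 g (dg x).
  by rewrite w2 => xw; apply: dG; lra.
have H2 x : (x - c) ^+ 2 <= w ^+ 2 -> {for x, continuous dg}.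
  by rewrite w2 => xw; apply: cG; lra.
rewrite -[RHS](chord_by_parts w0 H1 H2) [RHS]integral_mkcond; apply: eq_integral => x _.
rewrite epatch_indic/= -EFinM !indicE mulrC; congr (_ * (_)%:R)%:E.
  by rewrite w2; congr (_ - _ / _ * _); ring.
by congr nat_of_bool; apply/asbool_equiv_eq => /=; rewrite w2; split; lra.
Qed.

Variables a1 a2 : R.
Local Notation rdisc := (rdisc a1 a2).

(** It vanishes on the circle and its gradient is - (p - a), so integrating by parts against it
    trades a factor p - a for a derivative. *)
Definition cap (r : R) (p : R * R) : R :=
  (r ^+ 2 - (p.1 - a1) ^+ 2 - (p.2 - a2) ^+ 2) / 2.

Let cfst : continuous (fun p : R * R => p.1 - a1).
Proof. by move=> p; apply: cvgB; [exact: cvg_fst|exact: cvg_cst]. Qed.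

Let csnd : continuous (fun p : R * R => p.2 - a2).
Proof. by move=> p; apply: cvgB; [exact: cvg_snd|exact: cvg_cst]. Qed.

Lemma bcont_fst r : 0 < r -> bcont (rdisc r) (fun p => p.1 - a1).
Proof.
move=> r0; split; first by move=> p _; exact: cfst.
exists r => p; rewrite /rdisc/= => pr; rewrite ler_norml.
by move: (sqr_ge0 (p.2 - a2)) => ?; apply/andP; split; nra.
Qed.

Lemma bcont_snd r : 0 < r -> bcont (rdisc r) (fun p => p.2 - a2).
Proof.
move=> r0; split; first by move=> p _; exact: csnd.
exists r => p; rewrite /rdisc/= => pr; rewrite ler_norml.
by move: (sqr_ge0 (p.1 - a1)) => ?; apply/andP; split; nra.
Qed.

Lemma bcont_cap r : 0 < r -> bcont (rdisc r) (cap r).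
Proof.
move=> r0; apply: bcontM; last exact: bcont_cst.
apply: bcontD; last by apply: bcontN; apply: bcontM; exact: bcont_snd.
apply: bcontD; first exact: bcont_cst.
by apply: bcontN; apply: bcontM; exact: bcont_fst.
Qed.

Lemma rdiscS r r' : 0 < r -> r <= r' -> rdisc r `<=` rdisc r'.
Proof.
move=> r0 rr' p; rewrite /rdisc/= => /lt_le_trans; apply.
by rewrite ler_pXn2r// nnegrE; lra.
Qed.

(** The difference of the two sides vanishes chord by chord. The larger radius [r'] supplies
    regularity on the closed disc of radius [r]. Each conjunct carries only the hypotheses on its
    own partial derivative, so the two can be applied separately. *)
Lemma rdisc_by_parts r r' (h h1 h2 : R * R -> R) : 0 < r -> r < r' ->
  bcont (rdisc r') h ->
  (bcont (rdisc r') h1 ->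
   (forall p, rdisc r' p -> is_derive p.1 1 (fun s => h (s, p.2)) (h1 p)) ->
   \int[mu2]_(p in rdisc r) ((p.1 - a1) * h p) =
     \int[mu2]_(p in rdisc r) (cap r p * h1 p)) /\
  (bcont (rdisc r') h2 ->
   (forall p, rdisc r' p -> is_derive p.2 1 (fun t => h (p.1, t)) (h2 p)) ->
   \int[mu2]_(p in rdisc r) ((p.2 - a2) * h p) =
     \int[mu2]_(p in rdisc r) (cap r p * h2 p)).
Proof.
move=> r0 rr' bh.
have SS := rdiscS r0 (ltW rr').
have inr' x y : (x - a1) ^+ 2 + (y - a2) ^+ 2 <= r ^+ 2 -> rdisc r' (x, y).
  by rewrite /rdisc/= => /le_lt_trans; apply; rewrite ltr_pXn2r// nnegrE; lra.
have bf : bcont (rdisc r) (fun p => (p.1 - a1) * h p).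
  by apply: bcontM; [exact: bcont_fst|exact: bcontS bh].
have bs : bcont (rdisc r) (fun p => (p.2 - a2) * h p).
  by apply: bcontM; [exact: bcont_snd|exact: bcontS bh].
have mD := measurable_rdisc a1 a2 r.
split=> [bh1 d1|bh2 d2]; apply/eqP; rewrite -subr_eq0; apply/eqP.
  have bc1 : bcont (rdisc r) (fun p => cap r p * h1 p).
    by apply: bcontM; [exact: bcont_cap|exact: bcontS bh1].
  rewrite -(RintegralB mD (rdisc_integrable r0 bf) (rdisc_integrable r0 bc1)).
  rewrite /Rintegral -(proj2 (rdisc_fubini r0 (bcontD bf (bcontN bc1)))).
  rewrite (@eq_integral _ _ _ _ _ (fun=> 0%E)) ?integral0// => t _.
  apply: (@chord_section r a1 a2 t (fun s => h (s, t)) (fun s => h1 (s, t))) => //.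
    by move=> x xt; exact: (d1 (x, t) (inr' _ _ xt)).
  move=> x xt; apply: (@continuous_comp _ _ _ (fun s => (s, t)) h1).
    by apply: continuous_pair => ?; [exact: cvg_id|exact: cvg_cst].
  by apply: (proj1 bh1); exact: inr'.
have bc2 : bcont (rdisc r) (fun p => cap r p * h2 p).
  by apply: bcontM; [exact: bcont_cap|exact: bcontS bh2].
rewrite -(RintegralB mD (rdisc_integrable r0 bs) (rdisc_integrable r0 bc2)).
rewrite /Rintegral -(proj1 (rdisc_fubini r0 (bcontD bs (bcontN bc2)))).
rewrite (@eq_integral _ _ _ _ _ (fun=> 0%E)) ?integral0// => s _.
apply: etrans (@chord_section r a2 a1 s (fun t => h (s, t))
  (fun t => h2 (s, t)) r0 _ _).
- apply: eq_integral => t _; congr ((_ * (_ - _ / 2 * _))%:E).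
    by rewrite !indicE; congr (nat_of_bool _)%:R; apply/asbool_equiv_eq => /=; rewrite addrC.
  by rewrite /=; ring.
- by move=> x xt; apply: (d2 (s, x)); apply: inr'; lra.
- move=> x xt; apply: (@continuous_comp _ _ _ (fun t => (s, t)) h2).
    by apply: continuous_pair => ?; [exact: cvg_cst|exact: cvg_id].
  by apply: (proj1 bh2); apply: inr'; lra.
Qed.

Lemma Rintegral_rdisc_cst r c : 0 < r ->
  \int[mu2]_(p in rdisc r) c = c * (pi * r ^+ 2).
Proof.
move=> r0; rewrite Rintegral_cst//; last exact: measurable_rdisc.
by rewrite -[X in fine X]/(mu2 _) rdisc_area.
Qed.

(** Integrating by parts with h = x - a1 and h = y - a2 shows that the integrals of (x - a1)^2 and
    (y - a2)^2 both equal that of [cap r]. As r^2 = (x - a1)^2 + (y - a2)^2 + 2 cap, integration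
    gives pi r^4 = 4 times the integral of [cap r]. *)
Lemma Rintegral_cap r : 0 < r ->
  \int[mu2]_(p in rdisc r) cap r p = pi * r ^+ 4 / 4.
Proof.
move=> r0; have r0' : 0 < r + 1 by lra.
have rr' : r < r + 1 by lra.
have mD := measurable_rdisc a1 a2 r.
have bf := bcont_fst r0; have bs := bcont_snd r0; have bc := bcont_cap r0.
have i p := @rdisc_integrable R a1 a2 r p r0.
have D1 (x c : R) : is_derive x 1 (fun s : R => s - c) 1.
  by apply: is_derive_eq; rewrite subr0.
have E1 := proj1 (rdisc_by_parts (fun=> 1) (fun=> 0) r0 rr' (bcont_fst r0'))
  (bcont_cst _ 1) (fun p _ => D1 p.1 a1).
have E2 := proj2 (rdisc_by_parts (fun=> 0) (fun=> 1) r0 rr' (bcont_snd r0'))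
  (bcont_cst _ 1) (fun p _ => D1 p.2 a2).
have : \int[mu2]_(p in rdisc r) (r ^+ 2) =
  \int[mu2]_(p in rdisc r) ((p.1 - a1) * (p.1 - a1) + (p.2 - a2) * (p.2 - a2)
     + 2 * cap r p).
  by apply: eq_Rintegral => p _; rewrite /cap; lra.
rewrite (RintegralD mD (i _ (bcontD (bcontM bf bf) (bcontM bs bs)))
  (i _ (bcontM (bcont_cst _ 2) bc))).
rewrite (RintegralD mD (i _ (bcontM bf bf)) (i _ (bcontM bs bs))).
rewrite E1 E2 Rintegral_rdisc_cst// (RintegralZl 2 mD (i _ bc)).
have -> : \int[mu2]_(p in rdisc r) (cap r p * 1) = \int[mu2]_(p in rdisc r) cap r p.
  by apply: eq_Rintegral => p _; rewrite mulr1.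
lra.
Qed.

Definition homothety (x : R) (p : R * R) : R * R :=
  (a1 + x * (p.1 - a1), a2 + x * (p.2 - a2)).

Lemma continuous_homothety x : continuous (homothety x).
Proof.
apply: continuous_pair => p; (apply: cvgD; first exact: cvg_cst);
  (apply: cvgM; first exact: cvg_cst).
  exact: cfst.
exact: csnd.
Qed.

Lemma homothety_rdisc r r' x p : 0 < r -> 0 < r' -> `|x| * r <= r' ->
  rdisc r p -> rdisc r' (homothety x p).
Proof.
move=> r0 r'0 xr; rewrite /rdisc/= => pr.
have [->|x0] := eqVneq x 0.
  by rewrite !mul0r !addr0 !subrr expr0n/= addr0 exprn_gt0.
have : (`|x| * r) ^+ 2 <= r' ^+ 2.
  by rewrite ler_pXn2r// nnegrE ?mulr_ge0 ?(ltW r0) ?(ltW r'0).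
apply: lt_le_trans; rewrite exprMn real_normK ?num_real//.
have -> : (a1 + x * (p.1 - a1) - a1) ^+ 2 + (a2 + x * (p.2 - a2) - a2) ^+ 2 =
  x ^+ 2 * ((p.1 - a1) ^+ 2 + (p.2 - a2) ^+ 2) by ring.
by rewrite ltr_pM2l// exprn_even_gt0.
Qed.

Lemma disc_mean_value r r' (H H1 H2 H11 H22 : R * R -> R) (M : R) :
  0 < r -> r < r' ->
  bcont (rdisc r') H -> bcont (rdisc r') H1 -> bcont (rdisc r') H2 ->
  bcont (rdisc r') H11 -> bcont (rdisc r') H22 ->
  (forall p x, rdisc r' (homothety x p) ->
    is_derive x 1 (fun x => H (homothety x p))
      ((p.1 - a1) * H1 (homothety x p) + (p.2 - a2) * H2 (homothety x p))) ->
  (forall p, rdisc r' p -> is_derive p.1 1 (fun s => H1 (s, p.2)) (H11 p)) ->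
  (forall p, rdisc r' p -> is_derive p.2 1 (fun t => H2 (p.1, t)) (H22 p)) ->
  (forall p, rdisc r p -> H11 p + H22 p <= - (4 * M)) ->
  \int[mu2]_(p in rdisc r) H p <= pi * r ^+ 2 * H (a1, a2) - M * (pi * r ^+ 4 / 2).
Proof.
move=> r0 rr' bH bH1 bH2 bH11 bH22 dH dH1 dH2 lap.
have r'0 : 0 < r' by lra.
have mD := measurable_rdisc a1 a2 r.
have i p := @rdisc_integrable R a1 a2 r p r0.
have SS := rdiscS r0 (ltW rr').
(* The homotheties with [|x| < r' / r] send the disc of radius [r] into that of radius [r']; this
   open interval contains [[0, 1]], so [m] is differentiable at 0 and 1 too. *)
have q1 : 1 < r' / r by rewrite ltr_pdivlMr// mul1r.
have homr x p : `|x| < r' / r -> rdisc r p -> rdisc r' (homothety x p).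
  by move=> xr; apply: homothety_rdisc => //; rewrite -ler_pdivlMr// ltW.
have hom1 x s p : 0 < s -> `|x| <= 1 -> rdisc s p -> rdisc s (homothety x p).
  by move=> s0 x1; apply: homothety_rdisc => //; rewrite ler_piMl// ltW.
have bhr x (h : R * R -> R) : `|x| < r' / r -> bcont (rdisc r') h ->
    bcont (rdisc r) (fun p => h (homothety x p)).
  move=> xr bh; apply: (bcont_comp _ _ bh) => [|p]; first exact: continuous_homothety.
  exact: homr.
have bh1 x (h : R * R -> R) : `|x| <= 1 -> bcont (rdisc r') h ->
    bcont (rdisc r') (fun p => h (homothety x p)).
  move=> x1 bh; apply: (bcont_comp _ _ bh) => [|p]; first exact: continuous_homothety.
  exact: hom1.
pose f x p := H (homothety x p).
pose m x := \int[mu2]_(p in rdisc r) f x p.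
pose df x p := (p.1 - a1) * H1 (homothety x p) + (p.2 - a2) * H2 (homothety x p).
have inI (x : R) : `](- (r' / r)), (r' / r)[%classic x -> `|x| < r' / r.
  by rewrite /= in_itv/= ltr_norml.
(* A constant dominating the derivative, as required for differentiation under the integral sign. *)
have [K HK] : exists K : R, forall x p, `|x| < r' / r -> rdisc r p -> `|df x p| <= K.
  have [_ [K1 HK1]] := bH1; have [_ [K2 HK2]] := bH2.
  have [_ [L1 HL1]] := bcont_fst r0; have [_ [L2 HL2]] := bcont_snd r0.
  exists (L1 * K1 + L2 * K2) => x p xr rp.
  rewrite (le_trans (ler_normD _ _))// !normrM lerD// ler_pM//.
  - exact: HL1.
  - exact/HK1/homr.
  - exact: HL2.
  - exact/HK2/homr.
have d1f x p : `|x| < r' / r -> rdisc r p -> partial1of2 f x p = df x p.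
  move=> xr rp; rewrite partial1of2E; apply: derive_val.
  exact/dH/homr.
have derm (x : R) : `|x| < r' / r -> is_derive x 1 m (\int[mu2]_(p in rdisc r) df x p).
  move=> xr.
  have Ix : `](- (r' / r)), (r' / r)[%classic x by rewrite /= in_itv/= -ltr_norml.
  have h1 (y : R) : `](- (r' / r)), (r' / r)[%classic y ->
      mu2.-integrable (rdisc r : set R2) (EFin \o f y).
    by move=> /inI yr; apply: i; exact: bhr.
  have h2 (y : R) p : `](- (r' / r)), (r' / r)[%classic y -> rdisc r p ->
      derivable (f ^~ p) y 1.
    by move=> /inI yr rp; have [] := dH p y (homr _ _ yr rp).
  have h3 : mu2.-integrable (rdisc r : set R2) (EFin \o (fun=> `|K|)).
    by apply: (i (fun=> `|K|)); exact: bcont_cst.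
  have h4 (y : R) p : `](- (r' / r)), (r' / r)[%classic y -> rdisc r p ->
      `|partial1of2 f y p| <= `|K|.
    move=> /inI yr rp; rewrite d1f// (le_trans (HK _ _ yr rp))//.
    exact: ler_norm.
  have D := derivable_under_integral mD Ix h1 h2 (fun=> normr_ge0 K) h3 h4.
  have E := differentiation_under_integral mD Ix h1 h2 (fun=> normr_ge0 K) h3 h4.
  split; first exact: D.
  rewrite -derive1E [LHS]E; apply: eq_Rintegral => p /set_mem rp.
  exact: d1f.
have dfle (x : R) : 0 <= x <= 1 ->
    \int[mu2]_(p in rdisc r) df x p <= - (M * (pi * r ^+ 4)) * x.
  move=> /andP[x0 x1]; have nx : `|x| <= 1 by rewrite ger0_norm.
  have nx' : `|x| < r' / r by exact: le_lt_trans q1.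
  have bf := bcont_fst r0; have bs := bcont_snd r0; have bc := bcont_cap r0.
  have bx := bcont_cst (rdisc r') x.
  rewrite /df (RintegralD mD (i _ (bcontM bf (bhr x _ nx' bH1)))
    (i _ (bcontM bs (bhr x _ nx' bH2)))).
  have dA (c y : R) : is_derive y 1 (fun s : R => c + x * (s - c)) x.
    by apply: is_derive_eq; rewrite /GRing.scale/=; ring.
  have d1 p : rdisc r' p -> is_derive p.1 1 (fun s => H1 (homothety x (s, p.2)))
      (x * H11 (homothety x p)).
    move=> rp; have dd := dH1 _ (hom1 _ _ _ r'0 nx rp).
    rewrite mulrC; exact: (@is_derive1_comp R (fun s => H1 (s, (homothety x p).2))
      (fun s => a1 + x * (s - a1)) p.1 _ x dd (dA a1 p.1)).
  have d2 p : rdisc r' p -> is_derive p.2 1 (fun t => H2 (homothety x (p.1, t)))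
      (x * H22 (homothety x p)).
    move=> rp; have dd := dH2 _ (hom1 _ _ _ r'0 nx rp).
    rewrite mulrC; exact: (@is_derive1_comp R (fun t => H2 ((homothety x p).1, t))
      (fun t => a2 + x * (t - a2)) p.2 _ x dd (dA a2 p.2)).
  (* Differentiating [H1] and [H2] along the homothety brings out the factor [x], so the bound for
     the derivative of [m] is linear in [x]. *)
  have E1 := proj1 (rdisc_by_parts (fun p => x * H11 (homothety x p)) (fun=> 0)
    r0 rr' (bh1 x _ nx bH1)) (bcontM bx (bh1 x _ nx bH11)) d1.
  have E2 := proj2 (rdisc_by_parts (fun=> 0) (fun p => x * H22 (homothety x p))
    r0 rr' (bh1 x _ nx bH2)) (bcontM bx (bh1 x _ nx bH22)) d2.
  rewrite {}E1 {}E2.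
  have b1 := bcontM bc (bcontM (bcont_cst _ x) (bhr x _ nx' bH11)).
  have b2 := bcontM bc (bcontM (bcont_cst _ x) (bhr x _ nx' bH22)).
  rewrite -(RintegralD mD (i _ b1) (i _ b2)).
  (* By [Rintegral_cap], the integral of [4 * M * cap r p] is [M * (pi * r ^+ 4)]. The integrands
     can now be compared pointwise, since [x * cap r p] is nonnegative on the disc. *)
  have -> : - (M * (pi * r ^+ 4)) * x =
      \int[mu2]_(p in rdisc r) (- (4 * M) * x * cap r p).
    by rewrite (RintegralZl _ mD (i _ bc)) Rintegral_cap//; lra.
  apply: le_Rintegral => //.
  - exact: (i _ (bcontD b1 b2)).
  - exact: (i _ (bcontM (bcont_cst _ (- (4 * M) * x)) bc)).
  - move=> p rp.
    have c0 : 0 <= x * cap r p.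
      by rewrite mulr_ge0// /cap; move: rp; rewrite /rdisc/=; lra.
    have := ler_wpM2l c0 (lap _ (hom1 _ _ _ r0 nx rp)).
    by lra.
(* The quadratic term compensates the bound of [dfle], so [k] decreases on [[0, 1]]. The claim is
   [k 1 <= k 0]: [m 1] is the integral of [H], and [m 0] is the area times the value at the
   centre. *)
pose k x := m x + M * (pi * r ^+ 4 / 2) * x ^+ 2.
have dk (x : R) : `|x| < r' / r -> is_derive x 1 k
    (\int[mu2]_(p in rdisc r) df x p + M * (pi * r ^+ 4) * x).
  move=> xr; have ? := derm x xr.
  by apply: is_derive_eq; rewrite /GRing.scale/=; lra.
have nI (x : R) : 0 <= x -> x <= 1 -> `|x| < r' / r.
  by move=> x0 x1; rewrite ger0_norm//; exact: le_lt_trans q1.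
have kk : k 1 <= k 0.
  apply: (@ler0_derive1_le_cc R k 0 1).
  - move=> x; rewrite in_itv/= => /andP[x0 x1].
    by have [] := dk x (nI _ (ltW x0) (ltW x1)).
  - move=> x; rewrite in_itv/= => /andP[x0 x1].
    have H0 := nI _ (ltW x0) (ltW x1).
    rewrite derive1E (@derive_val _ _ _ _ _ _ _ (dk x H0)).
    by rewrite -lerBrDr sub0r -mulNr; apply: dfle; rewrite !ltW.
  - apply: continuous_in_subspaceT => x /set_mem/=; rewrite in_itv/= => /andP[x0 x1].
    apply: differentiable_continuous; apply/derivable1_diffP.
    by have [] := dk x (nI _ x0 x1).
  - by rewrite in_itv/= lexx ler01.
  - by rewrite in_itv/= lexx ler01.
  - exact: ler01.
move: kk; rewrite /k expr1n expr0n/= mulr0 addr0 mulr1.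
have -> : m 1 = \int[mu2]_(p in rdisc r) H p.
  by apply: eq_Rintegral => p _; rewrite /f /homothety !mul1r !subrKC; case: p.
have -> : m 0 = H (a1, a2) * (pi * r ^+ 2).
  rewrite -Rintegral_rdisc_cst//.
  by apply: eq_Rintegral => p _; rewrite /f /homothety !mul0r !addr0.
lra.
Qed.

End mean_value.

(** * Functions continuous up to the boundary *)

Section functions_up_to_the_boundary.
Variables (R : realType) (V : normedModType R) (D : set V).
Hypothesis compactD : compact (closure D).

(** Heine-Cantor by a covering argument with the radius as parameter: around each point of [A] all
    small radii work for all nearby points, and compactness makes one radius work on all of [A]. *)
Lemma uniformly_continuous_compact (A : set V) (h : V -> R) (e : R) :
  compact A -> {within A, continuous h} -> 0 < e ->
  exists2 d : R, 0 < d & forall x y, A x -> A y -> ball x d y -> `|h x - h y| < e.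
Proof.
move=> /compact_near_coveringP cA ch e0.
pose P (d : R) x := A x -> forall y, A y -> ball x d y -> `|h x - h y| < e.
have : \forall d \near (0 : R)^'+, A `<=` P d.
  apply: cA => x Ax.
  have e2 : 0 < e / 2 by lra.
  have /subspace_continuousP/(_ x Ax _ (nbhsx_ballx (h x) _ e2)) := ch.
  move=> /nbhs_ballP[d /= d0 dA].
  have hA z : A z -> ball x d z -> `|h x - h z| < e / 2.
    by move=> Az xz; exact: (dA z xz Az).
  exists (ball x (d / 2), [set s | s < d / 2]).
    split => /=; first by apply: nbhsx_ballx; lra.
    by apply: nbhs_right_lt; lra.
  move=> [x' s] /= [xx' sd] Ax' y Ay x'y.
  have xx'd : ball x d x' by apply: le_ball xx'; lra.
  have xy : ball x d y.
    by rewrite (splitr d); apply: ball_triangle xx' _; apply: le_ball x'y; exact: ltW.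
  have := hA _ Ay xy; have := hA _ Ax' xx'd.
  rewrite distrC => H1 H2.
  by rewrite (splitr e) (le_lt_trans (ler_distD (h x) _ _))// ltrD.
move=> H; have [d [d0 dP]] : exists d : R, 0 < d /\ A `<=` P d.
  near (0 : R)^'+ => d; exists d; split; near: d => //.
  exact: nbhs_right_gt.
by exists d => // x y Ax Ay; exact: dP.
Unshelve. all: by end_near. Qed.

(** This class is closed under sums, products and composition with continuous functions; as the
    closure of [D] is compact, its members are bounded and uniformly continuous on [D]. *)
Definition extendable (p : V -> R) :=
  (forall v, D v -> {for v, continuous p}) /\
  exists h : V -> R, {within closure D, continuous h} /\
    forall x, D x -> h x = p x.

Lemma extendable_bcont p : extendable p -> bcont D p.
Proof.
move=> [cp [h [ch hp]]]; split => //.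
have /compact_bounded[M [_ /(_ (`|M| + 1))]] := continuous_compact ch compactD.
rewrite (le_lt_trans (ler_norm M)) ?ltrDl// => /(_ isT) hM.
exists (`|M| + 1) => v Dv; rewrite -hp//; apply: hM.
by exists v => //; exact: subset_closure.
Qed.

Lemma extendable_unif p (e : R) : extendable p -> 0 < e ->
  exists2 d : R, 0 < d & forall x y, D x -> D y -> ball x d y -> `|p x - p y| < e.
Proof.
move=> [_ [h [ch hp]]] e0.
have [d d0 hd] := uniformly_continuous_compact compactD ch e0.
exists d => // x y Dx Dy xy; rewrite -!hp//.
by apply: hd => //; exact: subset_closure.
Qed.

Lemma extendable_continuous p : continuous p -> extendable p.
Proof.
move=> cp; split=> [v _|]; first exact: cp.
by exists p; split => //; exact: continuous_subspaceT.
Qed.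

Lemma extendableD p q : extendable p -> extendable q ->
  extendable (fun v => p v + q v).
Proof.
move=> [cp [h [ch hp]]] [cq [k [ck kq]]]; split.
  by move=> v Dv; apply: continuousD; [exact: cp|exact: cq].
exists (fun v => h v + k v); split=> [x|x Dx]; last by rewrite hp// kq.
by apply: continuousD; [exact: ch|exact: ck].
Qed.

Lemma extendableM p q : extendable p -> extendable q ->
  extendable (fun v => p v * q v).
Proof.
move=> [cp [h [ch hp]]] [cq [k [ck kq]]]; split.
  by move=> v Dv; apply: continuousM; [exact: cp|exact: cq].
exists (fun v => h v * k v); split=> [x|x Dx]; last by rewrite hp// kq.
by apply: continuousM; [exact: ch|exact: ck].
Qed.

Lemma extendable_comp (f : R -> R) p : continuous f -> extendable p ->
  extendable (fun v => f (p v)).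
Proof.
move=> cf [cp [h [ch hp]]]; split.
  by move=> v Dv; apply: (@continuous_comp _ _ _ p f); [exact: cp|exact: cf].
exists (fun v => f (h v)); split=> [x|x Dx]; last by rewrite hp.
by apply: (@continuous_comp _ _ _ (h : subspace (closure D) -> R) f); [exact: ch|exact: cf].
Qed.

Lemma smooth_extendable (f : V -> R) (vs : seq V) :
  smooth_on_closure D f -> extendable (Defs.iterD vs f).
Proof.
move=> /(_ vs)[df ext]; split=> // v /df.
exact: differentiable_continuous.
Qed.

End functions_up_to_the_boundary.

(** * Derivatives along lines *)

Section derivatives_along_lines.
Variables (R : realType) (V : normedModType R).

(** The difference quotient of [P] along the line and the one defining the directional derivative
    are the same function of [h]. *)
Lemma is_derive_line (P : V -> R) (l : R -> V) (d : V) (x : R) :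
  (forall h, l (h + x) = h *: d + l x) -> derivable P (l x) d ->
  is_derive x 1 (fun x => P (l x)) ('D_d P (l x)).
Proof.
move=> ld dP.
have E : (fun h : R => h^-1 *: (((fun x => P (l x)) \o shift x) (h *: (1 : R)) - P (l x))) =
    (fun h => h^-1 *: ((P \o shift (l x)) (h *: d) - P (l x))).
  by apply/funext => h /=; rewrite /GRing.scale/= mulr1 ld.
by split; rewrite /derivable /derive E.
Qed.

Lemma derive_lincomb (P : V -> R) (v d e : V) (s t : R) : differentiable P v ->
  'D_(s *: d + t *: e) P v = s * 'D_d P v + t * 'D_e P v.
Proof. by move=> dP; rewrite !deriveE// linearD !linearZ. Qed.

End derivatives_along_lines.

(** * Complex and real coordinates *)

Section coordinates.
Variable R : realType.
Variable n : nat.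
Local Notation C := R[i].
Implicit Types (s t : R) (y : 'rV[R]_(n + n)).

(** Lets estimates in the sup norm be checked coordinate by coordinate; the case distinction depends
    on the index [j] alone. *)
Lemma tzvecP (j : 'I_((1 + n) + (1 + n))) :
  [\/ forall s t y, tzvec s t y 0 j = s, forall s t y, tzvec s t y 0 j = t |
      exists k, forall s t y, tzvec s t y 0 j = y 0 k].
Proof.
rewrite /tzvec; case: (splitP j) => k jk.
  have -> : j = lshift (1 + n) k by exact: val_inj.
  case: (splitP k) => l kl.
    have -> : k = lshift n l by exact: val_inj.
    by constructor 1 => s t y; rewrite !row_mxEl mxE.
  have -> : k = rshift 1 l by exact: val_inj.
  by constructor 3; exists (lshift n l) => s t y; rewrite row_mxEl row_mxEr mxE.
have -> : j = rshift (1 + n) k by exact: val_inj.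
case: (splitP k) => l kl.
  have -> : k = lshift n l by exact: val_inj.
  by constructor 2 => s t y; rewrite row_mxEr row_mxEl mxE.
have -> : k = rshift 1 l by exact: val_inj.
by constructor 3; exists (rshift n l) => s t y; rewrite !row_mxEr mxE.
Qed.

Lemma tzvec_line (al be h s t : R) y :
  tzvec (h * al + s) (h * be + t) y =
  h *: (al *: tzvec 1 0 0 + be *: tzvec 0 1 0) + tzvec s t y.
Proof.
rewrite /tzvec !(scale_row_mx, add_row_mx).
by congr (row_mx (row_mx _ _) (row_mx _ _)); apply/rowP => j; rewrite !mxE; ring.
Qed.

Lemma toC_tzvec s t y : @toC R (1 + n) (tzvec s t y) = pt (Complex s t) (@toC R n y).
Proof.
apply/rowP => j; rewrite [LHS]mxE /tzvec /pt row_mxEl row_mxEr.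
case: (splitP j) => k jk.
  have -> : j = lshift n k by exact: val_inj.
  by rewrite !row_mxEl !mxE.
have -> : j = rshift 1 k by exact: val_inj.
by rewrite !row_mxEr !mxE.
Qed.

Lemma ofC_pt s t y : ofC (pt (Complex s t) (@toC R n y)) = tzvec s t y.
Proof.
rewrite /ofC /pt /tzvec !map_row_mx.
by congr (row_mx (row_mx _ _) (row_mx _ _)); apply/rowP => j; rewrite !mxE.
Qed.

Lemma e_sE : e_s R n = tzvec 1 0 0.
Proof.
rewrite /e_s -ofC_pt; congr (ofC (pt _ _)).
by apply/rowP => j; rewrite !mxE.
Qed.

Lemma e_tE : e_t R n = tzvec 0 1 0.
Proof.
rewrite /e_t -ofC_pt; congr (ofC (pt _ _)).
by apply/rowP => j; rewrite !mxE.
Qed.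

Lemma tau_of_pt (t : C) (z : 'rV[C]_n) : tau_of (pt t z) = t.
Proof. by rewrite /tau_of /pt row_mxEl mxE. Qed.

Lemma z_of_pt (t : C) (z : 'rV[C]_n) : z_of (pt t z) = z.
Proof. by rewrite /z_of /pt row_mxKr. Qed.

Lemma prodC_tzvec (U : set C) (O : set 'rV[C]_n) s t y :
  prodC U O (@toC R (1 + n) (tzvec s t y)) = (U (Complex s t) /\ O (@toC R n y)).
Proof. by rewrite toC_tzvec /prodC/= tau_of_pt z_of_pt. Qed.

Lemma tzvec_surj (v : 'rV[R]_((1 + n) + (1 + n))) :
  v = tzvec (v 0 (lshift (1 + n) (lshift n ord0)))
    (v 0 (rshift (1 + n) (lshift n ord0)))
    (row_mx (rsubmx (lsubmx v)) (rsubmx (rsubmx v))).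
Proof.
rewrite /tzvec row_mxKl row_mxKr -[LHS]hsubmxK.
rewrite -[lsubmx v in LHS]hsubmxK -[rsubmx v in LHS]hsubmxK.
by congr (row_mx (row_mx _ _) (row_mx _ _)); apply/rowP => j; rewrite !mxE ord1.
Qed.

Lemma ball_tzvec s t s' t' y (d : R) : 0 < d -> `|s - s'| < d -> `|t - t'| < d ->
  ball (tzvec s t y) d (tzvec s' t' y).
Proof.
move=> d0 sd td; split=> // i j; rewrite (ord1 i).
by case: (tzvecP j) => [E|E|[k E]]; rewrite !E//; exact: ballxx.
Qed.

Lemma mx_norm_le (m : nat) (v : 'rV[R]_m) (M : R) : 0 <= M ->
  (forall j, `|v 0 j| <= M) -> `|v| <= M.
Proof.
move=> M0 vM; rewrite [leLHS]/Num.norm/= mx_normrE.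
by apply/bigmax_leP; split=> // -[i j] _ /=; rewrite (ord1 i).
Qed.

Lemma bounded_preimageC m (A : set 'rV[C]_m) : boundedC A ->
  exists2 M : R, 0 <= M & forall v, A (@toC R m v) -> `|v| <= M.
Proof.
move=> [M [_ /(_ (`|M| + 1))]].
rewrite (le_lt_trans (ler_norm M)) ?ltrDl// => /(_ isT) AM.
by exists (`|M| + 1); [rewrite addr_ge0|move=> v Av; exact: AM].
Qed.

Definition cvec (s t : R) : 'rV[R]_(1 + 1) := row_mx (\row_(_ < 1) s) (\row_(_ < 1) t).

Lemma asC1_cvec (U : set C) s t : asC1 U (@toC R 1 (cvec s t)) = U (Complex s t).
Proof. by rewrite /asC1/= /cvec mxE row_mxEl row_mxEr !mxE. Qed.

Lemma bounded_asC1 (U : set C) : boundedC (asC1 U) ->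
  exists2 M : R, 0 <= M & forall s t, U (Complex s t) -> `|s| <= M /\ `|t| <= M.
Proof.
move=> /bounded_preimageC[M M0 UM]; exists M => // s t Ust.
have := UM (cvec s t); rewrite asC1_cvec => /(_ Ust) stM.
split; apply: le_trans stM.
  by have := ler_coord_norm (cvec s t) (lshift 1 ord0); rewrite row_mxEl mxE.
by have := ler_coord_norm (cvec s t) (rshift 1 ord0); rewrite row_mxEr mxE.
Qed.

Lemma compact_closure_prodC (U : set C) (O : set 'rV[C]_n) :
  boundedC (asC1 U) -> boundedC O ->
  compact (closure (@toC R (1 + n) @^-1` prodC U O)).
Proof.
move=> /bounded_asC1[M M0 UM] /bounded_preimageC[K K0 OK].
pose L := M + K.
have cL : closed [set v : 'rV[R]_((1 + n) + (1 + n)) | `|v| <= L].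
  apply: (@closed_comp _ _ (fun v : 'rV[R]_((1 + n) + (1 + n)) => `|v|)
    [set x | x <= L]); last exact: closed_le.
  by move=> v _; exact: (@norm_continuous _ 'rV[R]_((1 + n) + (1 + n))).
apply: (@subclosed_compact _ _ [set v | `|v| <= L]).
- exact: closed_closure.
- apply: bounded_closed_compact.
    by exists L; split; [exact: num_real|move=> x Lx v /= /le_trans; apply; exact: ltW].
  exact: cL.
- rewrite closureE; apply: smallest_sub => //.
  move=> v /=; rewrite (tzvec_surj v) prodC_tzvec => -[/UM[sM tM] /OK yK].
  apply: mx_norm_le => [|j]; first by rewrite addr_ge0.
  case: (tzvecP j) => [E|E|[k E]]; rewrite E.
  - by rewrite (le_trans sM)// lerDl.
  - by rewrite (le_trans tM)// lerDl.
  - by rewrite (le_trans (ler_coord_norm _ _))// (le_trans yK)// lerDr.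
Qed.

Lemma disc_rdisc (a1 a2 r s t : R) : 0 < r ->
  disc (Complex a1 a2) r (Complex s t) <-> rdisc a1 a2 r (s, t).
Proof.
move=> r0; rewrite /disc /rdisc/= /cabs/=.
by rewrite -{1}(ger0_norm (ltW r0)) -sqrtr_sqr ltr_sqrt// exprn_gt0.
Qed.

Lemma open_asC1_disc (U : set C) (a : C) : open (@toC R 1 @^-1` asC1 U) -> U a ->
  exists2 r : R, 0 < r & disc a r `<=` U.
Proof.
case: a => a1 a2 oU Ua.
have Ua' : (@toC R 1 @^-1` asC1 U) (cvec a1 a2) by rewrite /preimage/= asC1_cvec.
have /nbhs_ballP[e /= e0 eU] := open_nbhs_nbhs (conj oU Ua').
exists e => // -[s t] /(disc_rdisc _ _ _ _ e0); rewrite /rdisc/= => st.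
rewrite -asC1_cvec; apply: eU; split => // i j; rewrite (ord1 i).
case: (splitP j) => k jk.
  have -> : j = lshift 1 k by exact: val_inj.
  rewrite !row_mxEl !mxE /ball/= ltr_norml.
  by move: (sqr_ge0 (t - a2)) => ?; apply/andP; split; nra.
have -> : j = rshift 1 k by exact: val_inj.
rewrite !row_mxEr !mxE /ball/= ltr_norml.
by move: (sqr_ge0 (s - a1)) => ?; apply/andP; split; nra.
Qed.

(** Boundedness of [U] bounds the admissible radii, so the [sup] in [delta] is a genuine least upper
    bound. *)
Lemma lt_delta (U : set C) (a : C) (r r' : R) : boundedC (asC1 U) ->
  0 < r' -> disc a r' `<=` U -> r < r' -> r < delta U a.
Proof.
case: a => a1 a2 /bounded_asC1[M M0 UM] r'0 dU rr'.
apply: (lt_le_trans rr'); apply: ub_le_sup => //.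
(* A disc of radius [x] inside [U] contains its centre and the point at distance [x / 2] to the
   right; both real parts are at most [M] in absolute value, so [x / 2 <= 2 * M]. *)
exists (2 * (M + M)) => x /= [x0 xU].
have : U (Complex (a1 + x / 2) a2).
  by apply/xU/disc_rdisc => //; rewrite /rdisc/=; nra.
have : U (Complex a1 a2).
  by apply/xU/disc_rdisc => //; rewrite /rdisc/=; nra.
move=> /UM[a1M _] /UM[+ _]; move: a1M; rewrite !ler_norml => /andP[? ?] /andP[? ?].
lra.
Qed.

End coordinates.

(** * The weighted density on a fibre *)

Section fibre_estimate.
Variables (R : realType) (n : nat) (U : set R[i]) (O : set 'rV[R[i]]_n).
Variable phi : R[i] -> 'rV[R[i]]_n -> R.
Local Notation V := 'rV[R]_((1 + n) + (1 + n)).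
Local Notation D := (@toC R (1 + n) @^-1` prodC U O).
Local Notation mu2 := (@lebesgue_measure R \x @lebesgue_measure R)%E.
Hypothesis smooth_phi : smooth_on_closure D (phiR phi).
Hypothesis compactD : compact (closure D).

Local Notation E := (phiR phi).
Local Notation es := (e_s R n).
Local Notation et := (e_t R n).

Variables a1 a2 c1 c2 : R.

Definition cs (v : V) : R := v 0 (lshift (1 + n) (lshift n ord0)) - a1.
Definition ct (v : V) : R := v 0 (rshift (1 + n) (lshift n ord0)) - a2.

Lemma cs_tzvec s t y : cs (tzvec s t y) = s - a1.
Proof. by rewrite /cs /tzvec !row_mxEl mxE. Qed.

Lemma ct_tzvec s t y : ct (tzvec s t y) = t - a2.
Proof. by rewrite /ct /tzvec row_mxEr row_mxEl mxE. Qed.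

(* The weight is |1 + c (tau - a)|^2 with c = c1 + i c2, and wH is the weighted
   density |f|^2 e^{-phi}; wH1, wH2, wH11, wH22 are its partial derivatives in
   Re tau and Im tau. *)
Definition weight (x y : R) : R :=
  1 + 2 * c1 * x - 2 * c2 * y + (c1 ^+ 2 + c2 ^+ 2) * (x ^+ 2 + y ^+ 2).
Definition weight1 (x : R) : R := 2 * c1 + 2 * (c1 ^+ 2 + c2 ^+ 2) * x.
Definition weight2 (y : R) : R := - (2 * c2) + 2 * (c1 ^+ 2 + c2 ^+ 2) * y.

Definition wH (v : V) : R := weight (cs v) (ct v) * expR (- E v).
Definition wH1 (v : V) : R :=
  (weight1 (cs v) - weight (cs v) (ct v) * 'D_es E v) * expR (- E v).
Definition wH2 (v : V) : R :=
  (weight2 (ct v) - weight (cs v) (ct v) * 'D_et E v) * expR (- E v).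
Definition wH11 (v : V) : R :=
  (2 * (c1 ^+ 2 + c2 ^+ 2) - 2 * weight1 (cs v) * 'D_es E v
   - weight (cs v) (ct v) * ('D_es ('D_es E) v - 'D_es E v ^+ 2)) * expR (- E v).
Definition wH22 (v : V) : R :=
  (2 * (c1 ^+ 2 + c2 ^+ 2) - 2 * weight2 (ct v) * 'D_et E v
   - weight (cs v) (ct v) * ('D_et ('D_et E) v - 'D_et E v ^+ 2)) * expR (- E v).

Let ext_cs : extendable D cs.
Proof.
apply: extendable_continuous => v; apply: continuousB; last exact: cst_continuous.
exact: coord_continuous.
Qed.

Let ext_ct : extendable D ct.
Proof.
apply: extendable_continuous => v; apply: continuousB; last exact: cst_continuous.
exact: coord_continuous.
Qed.

Let ext_cst (c : R) : extendable D (fun=> c).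
Proof. by apply: extendable_continuous; exact: cst_continuous. Qed.

Let extN p : extendable D p -> extendable D (fun v => - p v).
Proof. by move=> ep; apply: (@extendable_comp _ _ _ -%R) => //; exact: opp_continuous. Qed.

Let extB p q : extendable D p -> extendable D q -> extendable D (fun v => p v - q v).
Proof. by move=> ep eq; apply: extendableD => //; exact: extN. Qed.

Let ext_E : extendable D E. Proof. exact: (smooth_extendable [::] smooth_phi). Qed.

Let ext_D1 d : extendable D ('D_d E).
Proof. exact: (smooth_extendable [:: d] smooth_phi). Qed.

Let ext_D2 d d' : extendable D ('D_d ('D_d' E)).
Proof. exact: (smooth_extendable [:: d; d'] smooth_phi). Qed.

Let ext_exp : extendable D (fun v => expR (- E v)).
Proof.
by apply: (@extendable_comp _ _ _ (fun x => expR (- x))) => // x;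
  apply: (@continuous_comp _ _ _ -%R expR); [exact: opp_continuous|exact: continuous_expR].
Qed.

Let ext_weight : extendable D (fun v => weight (cs v) (ct v)).
Proof.
apply: extendableD.
  apply: extB; last by apply: extendableM.
  by apply: extendableD => //; apply: extendableM.
apply: extendableM => //; apply: extendableD;
  by apply: (@extendable_comp _ _ _ (fun x => x ^+ 2)) => // x; exact: exprn_continuous.
Qed.

Let ext_weight1 : extendable D (fun v => weight1 (cs v)).
Proof. by apply: extendableD => //; apply: extendableM. Qed.

Let ext_weight2 : extendable D (fun v => weight2 (ct v)).
Proof. by apply: extendableD => //; apply: extendableM. Qed.

Lemma extendable_wH : extendable D wH.
Proof. by apply: extendableM. Qed.

Lemma extendable_wH1 : extendable D wH1.
Proof. by apply: extendableM => //; apply: extB => //; apply: extendableM. Qed.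

Lemma extendable_wH2 : extendable D wH2.
Proof. by apply: extendableM => //; apply: extB => //; apply: extendableM. Qed.

Let ext_sqr p : extendable D p -> extendable D (fun v => p v ^+ 2).
Proof.
by apply: (@extendable_comp _ _ _ (fun x => x ^+ 2)) => x; exact: exprn_continuous.
Qed.

Lemma extendable_wH11 : extendable D wH11.
Proof.
apply: extendableM => //; apply: extB.
  by apply: extB => //; apply: extendableM => //; apply: extendableM.
by apply: extendableM => //; apply: extB => //; exact: ext_sqr.
Qed.

Lemma extendable_wH22 : extendable D wH22.
Proof.
apply: extendableM => //; apply: extB.
  by apply: extB => //; apply: extendableM => //; apply: extendableM.
by apply: extendableM => //; apply: extB => //; exact: ext_sqr.
Qed.

Lemma is_derive_s (P : V -> R) s t y : differentiable P (tzvec s t y) ->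
  is_derive s 1 (fun s => P (tzvec s t y)) ('D_es P (tzvec s t y)).
Proof.
move=> dP; apply: (@is_derive_line _ _ P (fun s => tzvec s t y)) => [h|].
  rewrite e_sE -[in LHS](mulr1 h) -[t in LHS](add0r t) -[in LHS](mulr0 h) tzvec_line.
  by rewrite scale1r scale0r addr0.
exact: diff_derivable.
Qed.

Lemma is_derive_t (P : V -> R) s t y : differentiable P (tzvec s t y) ->
  is_derive t 1 (fun t => P (tzvec s t y)) ('D_et P (tzvec s t y)).
Proof.
move=> dP; apply: (@is_derive_line _ _ P (fun t => tzvec s t y)) => [h|].
  rewrite e_tE -[in LHS](mulr1 h) -[s in LHS](add0r s) -[in LHS](mulr0 h) tzvec_line.
  by rewrite scale1r scale0r add0r.
exact: diff_derivable.
Qed.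

Lemma is_derive_homothety (P : V -> R) p x y :
  differentiable P (tzvec (a1 + x * (p.1 - a1)) (a2 + x * (p.2 - a2)) y) ->
  is_derive x 1 (fun x => P (tzvec (a1 + x * (p.1 - a1)) (a2 + x * (p.2 - a2)) y))
    ((p.1 - a1) * 'D_es P (tzvec (a1 + x * (p.1 - a1)) (a2 + x * (p.2 - a2)) y) +
     (p.2 - a2) * 'D_et P (tzvec (a1 + x * (p.1 - a1)) (a2 + x * (p.2 - a2)) y)).
Proof.
move=> dP; rewrite -derive_lincomb//.
apply: (@is_derive_line _ _ P (fun x => tzvec _ _ y)) => [h|].
  by rewrite e_sE e_tE -tzvec_line; congr tzvec; ring.
exact: diff_derivable.
Qed.

Lemma is_derive_weight_exp (X Y e : R -> R) (dX dY de x : R) :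
  is_derive x 1 X dX -> is_derive x 1 Y dY -> is_derive x 1 e de ->
  is_derive x 1 (fun x => weight (X x) (Y x) * expR (- e x))
    ((weight1 (X x) * dX + weight2 (Y x) * dY - weight (X x) (Y x) * de) *
     expR (- e x)).
Proof.
move=> hX hY he; rewrite /weight.
apply: is_derive_eq.
rewrite /weight1 /weight2 /weight /GRing.scale/=; ring.
Qed.

(** Here [f] stands for the first partial derivative of phi along the line and [e] for phi itself;
    only the value of [f] at [x] has to match [de]. *)
Lemma is_derive_weight1_exp (b x de dde : R) (e f : R -> R) :
  is_derive x 1 e de -> is_derive x 1 f dde -> f x = de ->
  is_derive x 1
    (fun x => (weight1 (x - a1) - weight (x - a1) b * f x) * expR (- e x))
    ((2 * (c1 ^+ 2 + c2 ^+ 2) - 2 * weight1 (x - a1) * de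
      - weight (x - a1) b * (dde - de ^+ 2)) * expR (- e x)).
Proof.
move=> he hf fx; rewrite /weight /weight1.
apply: is_derive_eq.
rewrite fx /GRing.scale/=; ring.
Qed.

Lemma is_derive_weight2_exp (b x de dde : R) (e f : R -> R) :
  is_derive x 1 e de -> is_derive x 1 f dde -> f x = de ->
  is_derive x 1
    (fun x => (weight2 (x - a2) - weight b (x - a2) * f x) * expR (- e x))
    ((2 * (c1 ^+ 2 + c2 ^+ 2) - 2 * weight2 (x - a2) * de
      - weight b (x - a2) * (dde - de ^+ 2)) * expR (- e x)).
Proof.
move=> he hf fx; rewrite /weight /weight2.
apply: is_derive_eq.
rewrite fx /GRing.scale/=; ring.
Qed.

Let gradient_algebra (x y w w1 w2 p q e : R) :
  (w1 * x + w2 * y - w * (x * p + y * q)) * e =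
  x * ((w1 - w * p) * e) + y * ((w2 - w * q) * e).
Proof. by ring. Qed.

Lemma fibre_bcont r (P : V -> R) y : (forall p, rdisc a1 a2 r p -> U (Complex p.1 p.2)) ->
  O (@toC R n y) -> extendable D P ->
  bcont (rdisc a1 a2 r) (fun p => P (tzvec p.1 p.2 y)).
Proof.
move=> rU Oy /(extendable_bcont compactD).
apply: bcont_comp => [|p /rU Up]; last by rewrite /preimage/= prodC_tzvec.
apply: continuous_tzvec => p; [exact: cvg_fst|exact: cvg_snd|exact: cvg_cst].
Qed.

(** [disc_mean_value] on the fibre over z. The weight is 1 at tau = a, so the central value is that
    of e^{-phi} alone. *)
Lemma fibre_mean_value r r' (M : R) y : 0 < r -> r < r' ->
  (forall p, rdisc a1 a2 r' p -> U (Complex p.1 p.2)) -> O (@toC R n y) ->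
  (forall p, rdisc a1 a2 r p ->
    wH11 (tzvec p.1 p.2 y) + wH22 (tzvec p.1 p.2 y) <= - (4 * M)) ->
  \int[mu2]_(p in rdisc a1 a2 r) wH (tzvec p.1 p.2 y) <=
  pi * r ^+ 2 * expR (- E (tzvec a1 a2 y)) - M * (pi * r ^+ 4 / 2).
Proof.
move=> r0 rr' rU Oy lap.
have inD s t : rdisc a1 a2 r' (s, t) -> D (tzvec s t y).
  by move=> /rU Up; rewrite /preimage/= prodC_tzvec.
have dE v : D v -> differentiable E v by exact: (proj1 (smooth_phi [::])).
have dD d v : D v -> differentiable ('D_d E) v by exact: (proj1 (smooth_phi [:: d])).
have := @disc_mean_value R a1 a2 r r' (fun p => wH (tzvec p.1 p.2 y))
  (fun p => wH1 (tzvec p.1 p.2 y)) (fun p => wH2 (tzvec p.1 p.2 y))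
  (fun p => wH11 (tzvec p.1 p.2 y)) (fun p => wH22 (tzvec p.1 p.2 y)) M r0 rr'.
have -> : wH (tzvec (a1, a2).1 (a1, a2).2 y) = expR (- E (tzvec a1 a2 y)).
  by rewrite /wH cs_tzvec ct_tzvec /weight !subrr !mulr0 expr0n/= !addr0 subr0 mulr0 addr0 mul1r.
move=> mv; apply: mv; last exact: lap.
- exact: fibre_bcont extendable_wH.
- exact: fibre_bcont extendable_wH1.
- exact: fibre_bcont extendable_wH2.
- exact: fibre_bcont extendable_wH11.
- exact: fibre_bcont extendable_wH22.
- move=> p x /inD/dE dEx.
  have := is_derive_homothety dEx.
  set de := (X in is_derive _ _ _ X) => he.
  have hX : is_derive x 1 (fun x => x * (p.1 - a1)) (p.1 - a1).
    by apply: is_derive_eq; rewrite /GRing.scale/=; ring.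
  have hY : is_derive x 1 (fun x => x * (p.2 - a2)) (p.2 - a2).
    by apply: is_derive_eq; rewrite /GRing.scale/=; ring.
  have := is_derive_weight_exp hX hY he.
  set f1 := (X in is_derive _ _ X _ -> _); set f2 := (X in _ -> is_derive _ _ X _).
  have -> : f1 = f2.
    apply/funext => x'; rewrite /f1 /f2 /wH /= cs_tzvec ct_tzvec.
    by congr (weight _ _ * _); ring.
  move=> H; apply: is_derive_eq; rewrite /wH1 /wH2/= !cs_tzvec !ct_tzvec /de.
  rewrite (_ : a1 + x * (p.1 - a1) - a1 = x * (p.1 - a1)); last by ring.
  rewrite (_ : a2 + x * (p.2 - a2) - a2 = x * (p.2 - a2)); last by ring.
  exact: gradient_algebra.
- move=> [s t] /inD Dp /=.
  have h1 := is_derive_s (dE _ Dp); have h2 := is_derive_s (dD es _ Dp).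
  have := @is_derive_weight1_exp (t - a2) s _ _ _ _ h1 h2 erefl.
  rewrite /wH1 /wH11 cs_tzvec ct_tzvec.
  by under [X in _ -> is_derive _ _ X _]eq_fun do rewrite cs_tzvec ct_tzvec.
- move=> [s t] /inD Dp /=.
  have h1 := is_derive_t (dE _ Dp); have h2 := is_derive_t (dD et _ Dp).
  have := @is_derive_weight2_exp (s - a1) t _ _ _ _ h1 h2 erefl.
  rewrite /wH2 /wH22 cs_tzvec ct_tzvec.
  by under [X in _ -> is_derive _ _ X _]eq_fun do rewrite cs_tzvec ct_tzvec.
Qed.

End fibre_estimate.

(** * From the fibres to the product domain *)

Section density_bound.
Variables (R : realType) (n : nat) (U : set R[i]) (O : set 'rV[R[i]]_n).
Variable phi : R[i] -> 'rV[R[i]]_n -> R.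
Local Notation D := (@toC R (1 + n) @^-1` prodC U O).
Local Notation O' := (@toC R n @^-1` O).
Local Notation E := (phiR phi).
Local Notation es := (e_s R n).
Local Notation et := (e_t R n).

Lemma phiR_tzvec s t y : E (tzvec s t y) = phi (Complex s t) (@toC R n y).
Proof. by rewrite /phiR /uncurryC toC_tzvec tau_of_pt z_of_pt. Qed.

Let dtau_algebra (p q : R) :
  (Complex p 0 - iC R * Complex q 0) / 2%:R = Complex (p / 2) (- q / 2).
Proof.
apply: (canLR (mulfK _)); first by rewrite pnatr_eq0.
rewrite mulr_natr mulr2n.
by apply/eqP; rewrite eq_complex/=; apply/andP; split; apply/eqP; lra.
Qed.

Lemma dtau_tzvec s t y : dtau phi (Complex s t) (@toC R n y) =
  Complex ('D_es E (tzvec s t y) / 2) (- 'D_et E (tzvec s t y) / 2).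
Proof. by rewrite /dtau ofC_pt dtau_algebra. Qed.

Lemma cabs_sqr (z : R[i]) : cabs z ^+ 2 = cre z ^+ 2 + cim z ^+ 2.
Proof. by rewrite /cabs sqr_sqrtr// addr_ge0 ?sqr_ge0. Qed.

(** Four times the left-hand side of the curvature hypothesis in real coordinates; the Laplacian of
    e^{-phi} in tau is - [levi] e^{-phi}. *)
Definition levi (v : 'rV[R]_((1 + n) + (1 + n))) : R :=
  ('D_es ('D_es E) v - 'D_es E v ^+ 2) + ('D_et ('D_et E) v - 'D_et E v ^+ 2).

Let levi_algebra (p q p' q' : R) :
  4 * ((p' + q') / 4%:R - ((p / 2) ^+ 2 + (- q / 2) ^+ 2)) =
  (p' - p ^+ 2) + (q' - q ^+ 2).
Proof. by field. Qed.

Lemma levi_tzvec s t y :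
  4 * (ddbar phi (Complex s t) (@toC R n y) -
       cabs (dtau phi (Complex s t) (@toC R n y)) ^+ 2) =
  levi (tzvec s t y).
Proof.
rewrite /levi dtau_tzvec cabs_sqr /ddbar ofC_pt.
exact: levi_algebra.
Qed.

Let laplacian_algebra (w1 w2 w k p q p' q' e : R) :
  (2 * k - 2 * w1 * p - w * (p' - p ^+ 2)) * e +
  (2 * k - 2 * w2 * q - w * (q' - q ^+ 2)) * e =
  (4 * k - w * (p' - p ^+ 2 + (q' - q ^+ 2))) * e
  - 4 * (w1 * (p / 2 * e)) + 4 * (w2 * (- q / 2 * e)).
Proof. by field. Qed.

Lemma laplacianE a1 a2 c1 c2 v :
  wH11 phi a1 a2 c1 c2 v + wH22 phi a1 a2 c1 c2 v =
  (4 * (c1 ^+ 2 + c2 ^+ 2) - weight c1 c2 (cs a1 v) (ct a2 v) * levi v) * expR (- E v)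
  - 4 * (weight1 c1 c2 (cs a1 v) * ('D_es E v / 2 * expR (- E v)))
  + 4 * (weight2 c1 c2 (ct a2 v) * (- 'D_et E v / 2 * expR (- E v))).
Proof. by rewrite /wH11 /wH22 laplacian_algebra. Qed.

Lemma laplacian_unweighted a1 a2 v :
  wH11 phi a1 a2 0 0 v + wH22 phi a1 a2 0 0 v = - (levi v * expR (- E v)).
Proof.
rewrite laplacianE.
rewrite /weight1 /weight2 /weight expr0n/= !(addr0, mulr0, mul0r, oppr0, subr0).
by rewrite sub0r mul1r mulNr.
Qed.

Hypothesis smooth_phi : smooth_on_closure D (phiR phi).
Hypothesis compactD : compact (closure D).
Hypothesis openO : open O'.
Hypothesis boundedO : bounded_set O'.

Variables a1 a2 c1 c2 : R.

(* [dens1] and [dens2] are the real and imaginary parts of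
   (d phi / d tau) e^{-phi} at tau = a. *)
Definition dens0 (y : 'rV[R]_(n + n)) : R := expR (- E (tzvec a1 a2 y)).
Definition dens1 (y : 'rV[R]_(n + n)) : R := 'D_es E (tzvec a1 a2 y) / 2 * dens0 y.
Definition dens2 (y : 'rV[R]_(n + n)) : R := - 'D_et E (tzvec a1 a2 y) / 2 * dens0 y.

(** At tau = a the weight is 1 and its gradient is (2 c1, - 2 c2). Apart from the [levi] term, what
    remains is linear in the three densities, hence explicit after integration over z. *)
Lemma laplacian_center y :
  wH11 phi a1 a2 c1 c2 (tzvec a1 a2 y) + wH22 phi a1 a2 c1 c2 (tzvec a1 a2 y) =
  (4 * (c1 ^+ 2 + c2 ^+ 2) - levi (tzvec a1 a2 y)) * dens0 y
  - 8 * (c1 * dens1 y + c2 * dens2 y).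
Proof.
apply: (etrans (laplacianE a1 a2 c1 c2 (tzvec a1 a2 y))).
have -> : weight c1 c2 (cs a1 (tzvec a1 a2 y)) (ct a2 (tzvec a1 a2 y)) = 1.
  by rewrite cs_tzvec ct_tzvec !subrr /weight expr0n/= !(addr0, mulr0) subr0.
have -> : weight1 c1 c2 (cs a1 (tzvec a1 a2 y)) = 2 * c1.
  by rewrite cs_tzvec subrr /weight1 mulr0 addr0.
have -> : weight2 c1 c2 (ct a2 (tzvec a1 a2 y)) = - (2 * c2).
  by rewrite ct_tzvec subrr /weight2 mulr0 addr0.
rewrite -/(dens0 y) -/(dens1 y) -/(dens2 y).
by move: (levi _) (dens0 _) (dens1 _) (dens2 _) => l d0 d1 d2; ring.
Qed.

Lemma eMinusPhiE : eMinusPhi phi O (Complex a1 a2) = rint O' dens0.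
Proof.
have -> : dens0 = fun y => expR (- phi (Complex a1 a2) (@toC R n y)).
  by apply/funext => y; rewrite /dens0 phiR_tzvec.
by [].
Qed.

Lemma cintC_dtauE :
  cintC O (fun z => dtau phi (Complex a1 a2) z * Complex (expR (- phi (Complex a1 a2) z)) 0)
  = Complex (rint O' dens1) (rint O' dens2).
Proof.
have -> : dens1 = fun y => cre (dtau phi (Complex a1 a2) (@toC R n y) *
    Complex (expR (- phi (Complex a1 a2) (@toC R n y))) 0).
  by apply/funext => y; rewrite dtau_tzvec /dens1 /dens0 phiR_tzvec/= mulr0 subr0.
have -> : dens2 = fun y => cim (dtau phi (Complex a1 a2) (@toC R n y) *
    Complex (expR (- phi (Complex a1 a2) (@toC R n y))) 0).
  by apply/funext => y; rewrite dtau_tzvec /dens2 /dens0 phiR_tzvec/= mulr0 add0r.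
by [].
Qed.

Lemma bcont_dens (P : 'rV[R]_((1 + n) + (1 + n)) -> R) : U (Complex a1 a2) ->
  extendable D P -> bcont O' (fun y => P (tzvec a1 a2 y)).
Proof.
move=> Ua /(extendable_bcont compactD).
apply: bcont_comp => [|y Oy]; last by rewrite /preimage/= prodC_tzvec.
by apply: continuous_tzvec => y; [exact: cst_continuous|exact: cst_continuous|exact: cvg_id].
Qed.

Lemma bcont_dens0 : U (Complex a1 a2) -> bcont O' dens0.
Proof.
move=> Ua; apply: (bcont_dens Ua (P := fun v => expR (- E v))).
apply: (@extendable_comp _ _ _ (fun x => expR (- x))).
  move=> x; apply: (@continuous_comp _ _ _ -%R expR); first exact: opp_continuous.
  exact: continuous_expR.
exact: (smooth_extendable [::] smooth_phi).
Qed.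

Lemma prodC_toC (W : set R[i]) (v : 'rV[R]_((1 + n) + (1 + n))) :
  prodC W O (@toC R (1 + n) v) =
  (W (Complex (v 0 (lshift (1 + n) (lshift n ord0)))
              (v 0 (rshift (1 + n) (lshift n ord0)))) /\
   O (@toC R n (row_mx (rsubmx (lsubmx v)) (rsubmx (rsubmx v))))).
Proof. by rewrite -prodC_tzvec -tzvec_surj. Qed.

Lemma open_prodC_disc r : 0 < r ->
  open (@toC R (1 + n) @^-1` prodC (disc (Complex a1 a2) r) O).
Proof.
move=> r0.
pose st (v : 'rV[R]_((1 + n) + (1 + n))) :=
  (v 0 (lshift (1 + n) (lshift n ord0)), v 0 (rshift (1 + n) (lshift n ord0))).
pose yy (v : 'rV[R]_((1 + n) + (1 + n))) :=
  row_mx (rsubmx (lsubmx v)) (rsubmx (rsubmx v)).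
have -> : @toC R (1 + n) @^-1` prodC (disc (Complex a1 a2) r) O =
    (st @^-1` rdisc a1 a2 r) `&` (yy @^-1` O').
  apply/seteqP; split=> v; rewrite /preimage/= prodC_toC.
    by move=> [/(disc_rdisc _ _ _ _ r0) rv Ov]; split=> //; exact: rv.
  by move=> [rv Ov]; split=> //; exact/(disc_rdisc _ _ _ _ r0).
apply: openI; apply: open_comp => //.
- move=> v _; apply: continuous_pair => {}v; exact: coord_continuous.
- exact: open_rdisc.
- move=> v _; apply: continuous_row_mx; apply: continuous_mx => i j {}v;
    under eq_fun do rewrite !mxE; exact: coord_continuous.
Qed.

(** The constant M of [fibre_mean_value] may vary with z. Taking it to be a combination of the
    densities at a makes the integral of the fibre bounds over Omega explicit by linearity of
    [rint]. *)
Lemma density_bound r r' (m0 m1 m2 : R) : U (Complex a1 a2) -> 0 < r -> r < r' ->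
  (forall p, rdisc a1 a2 r' p -> U (Complex p.1 p.2)) ->
  (forall y p, O' y -> rdisc a1 a2 r p ->
    wH11 phi a1 a2 c1 c2 (tzvec p.1 p.2 y) + wH22 phi a1 a2 c1 c2 (tzvec p.1 p.2 y)
    <= - (4 * (m0 * dens0 y + m1 * dens1 y + m2 * dens2 y))) ->
  (intC (fun w : 'rV[R[i]]_(1 + n) =>
     (\1_(prodC (disc (Complex a1 a2) r) O) w *
      cabs (1 + Complex c1 c2 * (tau_of w - Complex a1 a2)) ^+ 2 *
      expR (- uncurryC phi w))%:E) <=
   (pi * r ^+ 2 * rint O' dens0 - pi * r ^+ 4 / 2 *
     (m0 * rint O' dens0 + m1 * rint O' dens1 + m2 * rint O' dens2))%:E)%E.
Proof.
move=> Ua r0 rr' rU lap.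
set Dr := @toC R (1 + n) @^-1` prodC (disc (Complex a1 a2) r) O.
have wE v : weight c1 c2 (cs a1 v) (ct a2 v) =
    cabs (1 + Complex c1 c2 * (tau_of (@toC R (1 + n) v) - Complex a1 a2)) ^+ 2.
  rewrite cabs_sqr /tau_of mxE/= /weight /cs /ct; ring.
have wH0 v : 0 <= wH phi a1 a2 c1 c2 v.
  by rewrite /wH wE mulr_ge0 ?sqr_ge0 ?expR_ge0.
rewrite /intC (@eq_iint _ _ _ (fun v => (\1_Dr v * wH phi a1 a2 c1 c2 v)%:E)); last first.
  by move=> v; rewrite -mulrA /wH wE.
have oDr : open Dr by exact: open_prodC_disc.
have SS := @rdiscS R a1 a2 r r' r0 (ltW rr').
have DrD : Dr `<=` D.
  move=> v; rewrite /Dr /preimage/= !prodC_toC => -[/(disc_rdisc _ _ _ _ r0) rv Ov].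
  by split=> //; apply: (rU (_, _)); apply: SS; exact: rv.
have extH := extendable_wH smooth_phi a1 a2 c1 c2.
rewrite iint_tzvec; last 2 first.
- apply: lsc_indicM => // v /DrD; exact: (proj1 extH).
- by move=> v; rewrite lee_fin mulr_ge0// indicE ler0n.
pose B y := pi * r ^+ 2 * dens0 y - pi * r ^+ 4 / 2 *
     (m0 * dens0 y + m1 * dens1 y + m2 * dens2 y).
have key y : (\int[lebesgue_measure]_s \int[lebesgue_measure]_t
    (\1_Dr (tzvec s t y) * wH phi a1 a2 c1 c2 (tzvec s t y))%:E <=
    (\1_O' y * B y)%:E)%E.
  have [Oy|nOy] := pselect (O' y); last first.
    rewrite (@eq_integral _ _ _ _ _ (fun=> 0%E)) ?integral0.
      by rewrite indicE memNset// mul0r.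
    move=> s _; rewrite (@eq_integral _ _ _ _ _ (fun=> 0%E)) ?integral0// => t _.
    rewrite indicE memNset ?mul0r//.
    by rewrite /Dr /preimage/= prodC_tzvec => -[].
  have bH := bcontS SS (fibre_bcont compactD rU Oy extH).
  apply: (@le_trans _ _ (\int[lebesgue_measure]_s \int[lebesgue_measure]_t
    (\1_(rdisc a1 a2 r) (s, t) * wH phi a1 a2 c1 c2 (tzvec s t y))%:E)%E).
    rewrite le_eqVlt; apply/orP; left; apply/eqP.
    apply: eq_integral => s _; apply: eq_integral => t _; congr ((_ * _)%:E).
    rewrite !indicE; congr (nat_of_bool _)%:R; apply/asbool_equiv_eq.
    rewrite /Dr /preimage/= prodC_tzvec; split=> [[/(disc_rdisc _ _ _ _ r0)]//|rst].
    by split=> //; exact/(disc_rdisc _ _ _ _ r0).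
  rewrite (proj1 (rdisc_fubini r0 bH)) indicE mem_set// mul1r.
  rewrite -[leLHS]fineK; last first.
    apply: integrable_fin_num; first exact: measurable_rdisc.
    exact: rdisc_integrable.
  rewrite lee_fin /B mulrC [X in _ <= _ - X]mulrC.
  rewrite [X in _ <= X - _]mulrC.
  apply: (fibre_mean_value smooth_phi compactD r0 rr' rU Oy) => p rp.
  exact: lap.
(* [B y] bounds the integral of a nonnegative function; its sign is what identifies its iterated
   integral with [rint]. *)
have B0 y : O' y -> 0 <= B y.
  move=> Oy; have := key y; rewrite indicE mem_set// mul1r -lee_fin.
  apply: le_trans; apply: integral_ge0 => s _; apply: integral_ge0 => t _.
  by rewrite lee_fin mulr_ge0// indicE ler0n.
have b0 := bcont_dens0 Ua.
have bD d := bcont_dens Ua (smooth_extendable [:: d] smooth_phi).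
have b1 : bcont O' dens1.
  by apply: bcontM => //; apply: bcontM; [exact: bD|exact: bcont_cst].
have b2 : bcont O' dens2.
  apply: bcontM => //; apply: bcontM; last exact: bcont_cst.
  by apply: bcontN; exact: bD.
have bc (c : R) := bcont_cst O' c.
have bM := bcontD (bcontD (bcontM (bc m0) b0) (bcontM (bc m1) b1)) (bcontM (bc m2) b2).
have bB : bcont O' B.
  by apply: bcontD; [exact: bcontM|apply: bcontN; exact: bcontM].
apply: (@le_trans _ _ (iint (fun y => (\1_O' y * B y)%:E))).
  apply: le_iint => // y; apply: integral_ge0 => s _; apply: integral_ge0 => t _.
  by rewrite lee_fin mulr_ge0// indicE ler0n.
rewrite (rint_ge0E openO boundedO bB B0) lee_fin.
have -> : B = fun y => pi * r ^+ 2 * dens0 y + - (pi * r ^+ 4 / 2) *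
     (m0 * dens0 y + m1 * dens1 y + m2 * dens2 y).
  by apply/funext => y; rewrite /B mulNr.
rewrite (rintD openO boundedO (bcontM (bc _) b0) (bcontM (bc _) bM)).
rewrite (rintZ openO boundedO _ b0) (rintZ openO boundedO _ bM).
rewrite (rintD openO boundedO (bcontD (bcontM (bc m0) b0) (bcontM (bc m1) b1)) (bcontM (bc m2) b2)).
rewrite (rintD openO boundedO (bcontM (bc m0) b0) (bcontM (bc m1) b1)).
by rewrite !(rintZ openO boundedO)// mulNr.
Qed.

End density_bound.

(** * Choice of the holomorphic function and of the radius *)

(** Meant for [L] the Laplacian at a nearby point, [l] the value of [levi] at the centre and [k] =
    |c|^2. Uniform continuity gives an error [4 * eps * e] independent of z; as [e] is a lower bound
    for the density [d0], the error is absorbed into [eps * d0]. *)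
Lemma laplacian_combine (R : realDomainType) (L k l g eps e d0 d1 d2 c1 c2 : R) :
  4 * g * d0 <= l * d0 -> eps * e <= eps * d0 ->
  - (4 * eps * e) < (4 * k - l) * d0 - 8 * (c1 * d1 + c2 * d2) - L ->
  L <= - (4 * ((g - eps - k) * d0 + 2 * c1 * d1 + 2 * c2 * d2)).
Proof. lra. Qed.

Lemma holomorphic_affine (R : realType) (A : set R[i]) (c a : R[i]) :
  holomorphic_on A (fun t => 1 + c * (t - a)).
Proof.
move=> t _; exists c => eps eps0; exists 1; split => // h h0 _.
have hN0 : h != 0.
  by apply/eqP => h0'; move: h0; rewrite h0' /cabs/= expr0n addr0 sqrtr0 ltxx.
have -> : (1 + c * (t + h - a) - (1 + c * (t - a))) / h - c = 0.
  by field.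
by rewrite /cabs/= expr0n addr0 sqrtr0.
Qed.

Theorem theorem3p6 (R : realType) (n : nat)
  (U : set R[i]) (O : set 'rV[R[i]]_n)
  (phi : R[i] -> 'rV[R[i]]_n -> R) (g : R[i] -> R) :
  domainC (asC1 U) -> boundedC (asC1 U) ->
  domainC O -> boundedC O ->
  psh (prodC U O) (uncurryC phi) ->
  smooth_on_closure (@toC R (1 + n) @^-1` prodC U O) (phiR phi) ->
  (forall t, U t -> 0 <= g t) ->
  (forall t z, U t -> O z -> ddbar phi t z - cabs (dtau phi t z) ^+ 2 >= g t) ->
  forall a : R[i], U a -> forall eps : R, 0 < eps ->
  exists r_eps : R, 0 < r_eps /\ r_eps < delta U a /\
    forall r : R, 0 < r -> r < r_eps ->
      exists f : R[i] -> R[i],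
        holomorphic_on (disc a r) f /\ f a = 1 /\
        (intC (fun w : 'rV[R[i]]_(1 + n) =>
            (\1_(prodC (disc a r) O) w * cabs (f (tau_of w)) ^+ 2
               * expR (- uncurryC phi w))%:E)
         <= (expR (- Num.max ((Gfun phi O g a - eps) / 2) 0 * r ^+ 2)
               * (pi * r ^+ 2) * eMinusPhi phi O a)%:E)%E.
Proof.
move=> domU bU domO bO _ smooth g0 ineq [a1 a2] Ua eps eps0.
have compactD := compact_closure_prodC bU bO.
have [openO _] := domO; have [openU _] := domU.
have [r0 r0_gt0 r0U] := open_asC1_disc openU Ua.
have rU r' : 0 < r' -> r' <= r0 ->
    forall p, rdisc a1 a2 r' p -> U (Complex p.1 p.2).
  move=> r'0 r'r0 [s t] rp; apply: r0U; apply/(disc_rdisc _ _ _ _ r0_gt0).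
  exact: (rdiscS r'0 r'r0 rp).
have leviE s t y : U (Complex s t) -> O (@toC R n y) ->
    4 * g (Complex s t) <= levi phi (tzvec s t y).
  by move=> Ust Oy; rewrite -levi_tzvec ler_pM2l//; exact: ineq.
pose I1 := rint (@toC R n @^-1` O) (dens1 phi a1 a2).
pose I2 := rint (@toC R n @^-1` O) (dens2 phi a1 a2).
rewrite /Gfun cintC_dtauE cabs_sqr/= eMinusPhiE -/I1 -/I2.
set F := rint _ (dens0 phi a1 a2).
have F0 : 0 <= F.
  rewrite -lee_fin -(rint_ge0E openO bO (bcont_dens0 smooth compactD Ua)).
    by apply: iint_ge0 => v; rewrite lee_fin mulr_ge0 ?expR_ge0// indicE ler0n.
  by move=> v _; exact: expR_ge0.
set G := g _ + _.
(* Common end of both cases. The factor 2 in the integrated bound cancels the 1/2 in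
   [pi * r ^+ 4 / 2], so [density_bound] yields pi r^2 F (1 - mx r^2), with mx the maximum in the
   exponent. *)
have conclude c1 c2 m0 m1 m2 r r' : 0 < r -> r < r' -> r' <= r0 ->
    m0 * F + m1 * I1 + m2 * I2 = 2 * Num.max ((G - eps) / 2) 0 * F ->
    (forall y p, (@toC R n @^-1` O) y -> rdisc a1 a2 r p ->
      wH11 phi a1 a2 c1 c2 (tzvec p.1 p.2 y) + wH22 phi a1 a2 c1 c2 (tzvec p.1 p.2 y)
      <= - (4 * (m0 * dens0 phi a1 a2 y + m1 * dens1 phi a1 a2 y + m2 * dens2 phi a1 a2 y))) ->
    exists f : R[i] -> R[i],
      holomorphic_on (disc (Complex a1 a2) r) f /\ f (Complex a1 a2) = 1 /\
      (intC (fun w : 'rV[R[i]]_(1 + n) =>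
          (\1_(prodC (disc (Complex a1 a2) r) O) w * cabs (f (tau_of w)) ^+ 2
             * expR (- uncurryC phi w))%:E)
       <= (expR (- Num.max ((G - eps) / 2) 0 * r ^+ 2)
             * (pi * r ^+ 2) * F)%:E)%E.
  move=> r_gt0 rr' r'r0 mE lap.
  exists (fun t => 1 + Complex c1 c2 * (t - Complex a1 a2)); split.
    exact: holomorphic_affine.
  split; first by rewrite subrr mulr0 addr0.
  apply: (le_trans (density_bound smooth compactD openO bO Ua r_gt0 rr'
    (rU _ (lt_trans r_gt0 rr') r'r0) lap)).
  rewrite -/F -/I1 -/I2 mE lee_fin.
  set mx := Num.max _ _.
  have : 0 <= pi * r ^+ 2 * F.
    by apply: mulr_ge0 => //; apply: mulr_ge0; [exact: pi_ge0|exact: sqr_ge0].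
  have := expR_ge1Dx (- mx * r ^+ 2).
  move=> H1 H2; have := ler_wpM2r H2 H1; lra.
have [Gle|Glt] := leP ((G - eps) / 2) 0.
  (* The maximum is 0 here, so c = 0 and a zero bound suffice: the Laplacian is - [levi] e^{-phi},
     which is nonpositive because [levi] is at least 4 g. *)
  exists (r0 / 2); split; first by lra.
  split; first by apply: (lt_delta bU r0_gt0 r0U); lra.
  move=> r r_gt0 rr0.
  have := conclude 0 0 0 0 0 r (r0 / 2) r_gt0 rr0; rewrite (max_r Gle); apply.
  - lra.
  - ring.
  - move=> y [s t] Oy rp /=.
    have Ust : U (Complex s t) by apply: (rU r _ _ (s, t)) => //; lra.
    rewrite laplacian_unweighted !mul0r !addr0 mulr0 oppr0 oppr_le0.
    apply: mulr_ge0 (expR_ge0 _); apply: le_trans (leviE _ _ _ Ust Oy).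
    by apply: mulr_ge0 => //; exact: g0.
pose c1 := I1 / F; pose c2 := I2 / F.
pose Lap v := wH11 phi a1 a2 c1 c2 v + wH22 phi a1 a2 c1 c2 v.
have extLap : extendable (@toC R (1 + n) @^-1` prodC U O) Lap.
  by apply: extendableD; [exact: extendable_wH11|exact: extendable_wH22].
have [_ [K EK]] := extendable_bcont compactD (smooth_extendable [::] smooth).
have inD s t y : U (Complex s t) -> O (@toC R n y) ->
    (@toC R (1 + n) @^-1` prodC U O) (tzvec s t y).
  by move=> Ust Oy; rewrite /preimage/= prodC_tzvec.
(* Since phi is bounded, the density at a has a positive lower bound uniform in z; it fixes the
   tolerance [4 * eps * expR (- K)] for uniform continuity. *)
have kdens y : O (@toC R n y) -> expR (- K) <= dens0 phi a1 a2 y.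
  move=> Oy; rewrite /dens0 ler_expR lerN2 (le_trans (ler_norm _))//.
  exact: (EK _ (inD _ _ _ Ua Oy)).
have e0 : 0 < 4 * eps * expR (- K) by rewrite !mulr_gt0 ?expR_gt0.
have [d d_gt0 Lapd] := extendable_unif compactD extLap e0.
(* The bound [r0 / 2] keeps a larger disc inside [U]; the bound [d] keeps the Laplacian within the
   tolerance of its value over the centre. *)
exists (Num.min (r0 / 2) d); split; first by rewrite lt_min d_gt0 andbT; lra.
split.
  by apply: (lt_delta bU r0_gt0 r0U); rewrite gt_min; apply/orP; left; lra.
move=> r r_gt0; rewrite lt_min => /andP[rr0 rd].
(* These coefficients come from [laplacian_combine]. Integrated over z they give (g - eps - |c|^2) F
   + 2 c1 I1 + 2 c2 I2, which equals (G - eps) F for c1 = I1 / F and c2 = I2 / F. *)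
have := conclude c1 c2 (g (Complex a1 a2) - eps - (c1 ^+ 2 + c2 ^+ 2))
  (2 * c1) (2 * c2) r (r0 / 2) r_gt0 rr0; rewrite (max_l (ltW Glt)); apply.
- lra.
- rewrite /c1 /c2 /G.
  (* If F = 0, the convention that the inverse of 0 is 0 gives c = 0, and both sides vanish. *)
  have [->|FN0] := eqVneq F 0; first by rewrite invr0; ring.
  by field.
- move=> y [s t] Oy rp /=.
  have Ust : U (Complex s t) by apply: (rU r _ _ (s, t)) => //; lra.
  have bst : ball (tzvec a1 a2 y) d (tzvec s t y).
    move: rp; rewrite /rdisc/= => rp.
    have := sqr_ge0 (s - a1); have := sqr_ge0 (t - a2) => ? ?.
    by apply: ball_tzvec => //; apply: (lt_trans _ rd); rewrite ltr_norml;
      apply/andP; split; nra.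
  have := Lapd _ _ (inD _ _ _ Ua Oy) (inD _ _ _ Ust Oy) bst.
  rewrite ltr_norml => /andP[+ _]; rewrite -/(Lap (tzvec s t y)).
  rewrite [Lap (tzvec a1 a2 y)]laplacian_center.
  have := ler_wpM2l (ltW eps0) (kdens _ Oy).
  have := ler_wpM2r (expR_ge0 (- phiR phi (tzvec a1 a2 y))) (leviE _ _ _ Ua Oy).
  rewrite -[expR (- phiR phi _)]/(dens0 phi a1 a2 y).
  exact: laplacian_combine.
Qed.
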